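(* For every integer $k \geq 8$ and every integer $m \geq 1$, \[ H(k+m, k) \cap \left\{ \tfrac{15}{16} 2^{k-1}, \tfrac{15}{16} 2^{k-1}+1, \dots, 2^{k-1}\right\}= \left\{ \tfrac{15}{16} 2^{k-1}, \tfrac{126}{128} 2^{k-1}, 2^{k-1} \right\}. \]
   Context: Let $\mathbb{H}^n=\{0,1\}^n\subseteq\mathbb{R}^n$. For $n\geq k$, $H(n,k)$ is the set of all possible sizes $|S\cap \mathbb{H}^n|$ where $S$ ranges over $k$-dimensional linear subspaces of $\mathbb{R}^n$; equivalently, $H(n,k)=\{\,|\mathbb{H}^k\cap L^{-1}(\mathbb{H}^{n-k})| : L:\mathbb{R}^k\to\mathbb{R}^{n-k}\text{ linear}\,\}$. The set $\{\tfrac{15}{16}2^{k-1},\dots,2^{k-1}\}$ denotes the integers from $\tfrac{15}{16}2^{k-1}$ to $2^{k-1}$ inclusive. *)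

(* Defs.v *)
From HB Require Import structures.
From mathcomp Require Import all_boot all_order all_algebra.
From mathcomp Require Import Rstruct.
From Stdlib Require Import Reals.
Set Implicit Arguments. Unset Strict Implicit. Unset Printing Implicit Defensive.
Import GRing.Theory.
Local Open Scope ring_scope.

Definition cube_vec (n : nat) (v : {ffun 'I_n -> bool}) : 'rV[R]_n :=
  \row_i (nat_of_bool (v i))%:R.

Definition cube_count (k n : nat) (A : 'M[R]_(k, n)) : nat :=
  #|[set v : {ffun 'I_n -> bool} | (cube_vec v <= A)%MS]|.

(* H(n,k): the set of sizes |S ∩ {0,1}^n| for S a k-dimensional linear
   subspace of R^n, S being the row space of a rank-k matrix A (k x n). *)
Definition Hset (n k : nat) (s : nat) : Prop :=
  exists A : 'M[R]_(k, n), \rank A = k /\ s = cube_count A.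

(* Main.v *)
(* Normalising a subspace to the row space of a matrix containing an identity
   block, |S /\ {0,1}^n| counts the x in {0,1}^k at which finitely many linear
   forms take values in {0,1}.  In terms of signs, and with one extra sign that
   makes the conditions homogeneous, one counts the sign vectors sigma such that
   |l . sigma| = 1 for all forms (rows) l of a finite list; let d be the density
   of these vectors.  The point is that d never lies in (15/32, 1/2) unless
   d = 126/256.

   - A row with many nonzero coefficients, or with a coefficient other than
     0, 1, -1, is controlled by the Littlewood-Offord bound; in the remaining
     cases d is a multiple of a large enough power of 1/2.  This leaves rows with
     coefficients 0, 1, -1 and exactly 1 (no condition), 3, 5, 7 or 9 nonzero
     entries.
   - If there is a row with 7 or 9 entries, exact counting shows that any further
     condition forces d <= 15/32; alone, such a row has density 35/64 or 126/256.
   - Rows with 5 entries are either proportional or share four spins with the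
     same relative signs, and then either at most six spins occur, or three rows
     share four spins, with density 7/16.
   - A row with 3 entries says that three (signed) spins are not all equal.
     Identifying the three spins in all possible ways writes d as a quarter of the
     sum of three densities of the same kind, each being 1, 3/4 or at most 5/8;
     the values 1 and 3/4 determine the shape of all the rows, which makes the
     three densities dyadic with small denominators. *)
Require Import Defs.
From HB Require Import structures.
From mathcomp Require Import all_boot all_order all_algebra.
From mathcomp Require Import finmap zify ring lra Rstruct.
Set Implicit Arguments. Unset Strict Implicit. Unset Printing Implicit Defensive.
Import Order.TTheory GRing.Theory Num.Theory.
Local Open Scope ring_scope.

(** * Densities of sets of sign vectors *)

Section Spins.
Variable I : finType.
Notation cube := {ffun I -> bool}.
Implicit Types (x : cube) (P Q : cube -> bool).

Definition dens P : rat := #|[pred x | P x]|%:R / 2 ^+ #|I|.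

Lemma card_cube : #|{: cube}| = (2 ^ #|I|)%N.
Proof. by rewrite card_ffun card_bool. Qed.

Lemma pow2_gt0 n : 0 < (2 : rat) ^+ n. Proof. by rewrite exprn_gt0. Qed.

Lemma cardP P : #|[pred x | P x]| = (\sum_x P x)%N.
Proof. by rewrite -sum1_card big_mkcond; apply: eq_bigr => x _; rewrite inE; case: (P x). Qed.

Lemma dens_ge0 P : 0 <= dens P.
Proof. by rewrite divr_ge0 ?ler0n ?ltW ?pow2_gt0. Qed.

Lemma dens_le P Q : (forall x, P x -> Q x) -> dens P <= dens Q.
Proof.
move=> PQ; rewrite ler_pM2r ?invr_gt0 ?pow2_gt0 // ler_nat.
by apply/subset_leq_card/subsetP => x; apply: PQ.
Qed.

Lemma eq_dens P Q : P =1 Q -> dens P = dens Q.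
Proof. by move=> e; apply/eqP; rewrite eq_le !dens_le // => x; rewrite e. Qed.

Lemma dens_lt P Q x : (forall x, P x -> Q x) -> Q x -> ~~ P x -> dens P < dens Q.
Proof.
move=> PQ Qx Px; rewrite ltr_pM2r ?invr_gt0 ?pow2_gt0 // ltr_nat.
apply/proper_card/properP; split; first by apply/subsetP => y; apply: PQ.
by exists x.
Qed.

Lemma dens_true P : (forall x, P x) -> dens P = 1.
Proof.
move=> PT; rewrite /dens cardP (eq_bigr (fun=> 1%N)) => [|x _]; last by rewrite PT.
by rewrite sum1_card card_cube natrX divff ?lt0r_neq0 ?pow2_gt0.
Qed.

Lemma dens_false P : (forall x, ~~ P x) -> dens P = 0.
Proof.
by move=> PF; rewrite /dens cardP big1 ?mul0r // => x _; rewrite (negbTE (PF x)).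
Qed.

Lemma dens_add P Q P' Q' : (forall x, P x + Q x = P' x + Q' x)%N ->
  dens P + dens Q = dens P' + dens Q'.
Proof.
move=> e; rewrite /dens -!mulrDl -!natrD !cardP -!big_split /=.
by congr (_%:R / _); apply: eq_bigr => x _.
Qed.


Lemma dens_bij (f : cube -> cube) P : involutive f -> dens (P \o f) = dens P.
Proof.
move=> fK; rewrite /dens !cardP; congr (_%:R / _).
by rewrite [RHS](reindex_inj (inv_inj fK)).
Qed.

Definition flip (u : I) x : cube := [ffun i => (i == u) (+) x i].

Lemma flipK u : involutive (flip u).
Proof. by move=> x; apply/ffunP => i; rewrite !ffunE addbA addbb. Qed.

Definition invariant_at u P := forall x, P (flip u x) = P x.

Section Dot.
Variable A : zmodType.
Implicit Type l : I -> A.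

(** [true] stands for the spin -1. Values in any [zmodType] allow integer triples, so that one form
    later records three rows at once. *)
Definition dot l x : A := \sum_i (if x i then - l i else l i).

Definition clear u l : I -> A := fun i => if i == u then 0 else l i.

Lemma dot_clear u l x :
  dot l x = dot (clear u l) x + (if x u then - l u else l u).
Proof.
rewrite /dot (bigD1 u) //= [in RHS](bigD1 u) //= addrC; congr (_ + _).
rewrite /clear eqxx oppr0 if_same add0r.
by apply: eq_bigr => i /negbTE->.
Qed.

Lemma eq_dot l x (y : cube) : (forall i, l i != 0 -> x i = y i) -> dot l x = dot l y.
Proof.
move=> e; apply: eq_bigr => i _; case: (eqVneq (l i) 0) => [->|/e->//].
by rewrite oppr0 !if_same.
Qed.

Lemma dot_flip0 u l x : l u = 0 -> dot l (flip u x) = dot l x.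
Proof.
move=> lu; apply: eq_dot => i; rewrite ffunE.
by case: (eqVneq i u) => [->|//]; rewrite lu eqxx.
Qed.

Lemma dot_flip u l x :
  dot l (flip u x) = dot (clear u l) x + (if x u then l u else - l u).
Proof.
rewrite (dot_clear u) dot_flip0; last by rewrite /clear eqxx.
by rewrite ffunE eqxx; case: (x u).
Qed.

Lemma dot_neg l x : dot l [ffun i => ~~ x i] = - dot l x.
Proof.
rewrite /dot -sumrN; apply: eq_bigr => i _; rewrite ffunE.
by case: (x i); rewrite ?opprK.
Qed.

(* Flipping the spin [u] is measure preserving, and it exchanges the two
   possible contributions [l u] and [- l u] of that spin. *)
Lemma dens_split u l Q (G : A -> bool) : invariant_at u Q ->
  2 * dens (fun x => Q x && G (dot l x)) =
  dens (fun x => Q x && G (dot (clear u l) x + l u)) +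
  dens (fun x => Q x && G (dot (clear u l) x - l u)).
Proof.
move=> Qu; rewrite mulr_natl mulr2n -{2}(dens_bij _ (flipK u)).
apply: dens_add => x /=; rewrite Qu dot_flip (dot_clear u).
by case: (x u); case: (Q x) => //=; rewrite addnC.
Qed.

End Dot.
End Spins.

(** * The Littlewood-Offord bound *)

(** This is the sum of the [v] largest binomial coefficients of order [n], or [2 ^ n] once [v]
    exceeds [n]; the recursion is Pascal's rule on a central block of coefficients. *)
Fixpoint lo (n v : nat) : nat :=
  match n, v with
  | 0, _ => 0 < v
  | _.+1, 0 => 0
  | n'.+1, v'.+1 => lo n' v'.+2 + lo n' v'
  end%N.

Lemma lo0 n : lo n 0 = 0%N. Proof. by case: n. Qed.

Lemma lo_concave n v : (lo n v.+2 + lo n v <= lo n v.+1 + lo n v.+1)%N.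
Proof.
elim: n v => [|n IH] [|v] //=.
  by have := IH 1%N; rewrite !lo0; lia.
by have := IH v; have := IH v.+2; lia.
Qed.


Lemma lo_mono n : {homo lo n : v w / (v <= w)%N}.
Proof.
apply: homo_leq => [//|a b c|v]; first exact: leq_trans.
elim: n v => [|n IH] [|v] //=; rewrite ?lo0 //.
by rewrite leq_add.
Qed.

Lemma lo_incr n a b : (a <= b)%N -> (lo n b.+1 + lo n a <= lo n b + lo n a.+1)%N.
Proof.
elim: b => [|b IH]; first by rewrite leqn0 => /eqP->; rewrite addnC.
rewrite leq_eqVlt => /orP[/eqP->|]; first by rewrite addnC.
by rewrite ltnS => /IH; have := lo_concave n b; lia.
Qed.

(** By concavity, two arguments with a fixed sum give a smaller total the further they are apart.
    The right-hand pair, at distance two, is the one in the recursion of [lo]. *)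
Lemma lo_spread n w t :
  (lo n (w + t + t).+2 + lo n w <= lo n (w + t).+2 + lo n (w + t))%N.
Proof.
elim: t w => [|t IH] w; first by rewrite !addn0.
have le : (w <= (w + t.+1 + t.+1).+1)%N by lia.
by have := IH w.+1; have := lo_incr n le; rewrite !(addSn, addnS); lia.
Qed.

Section LittlewoodOfford.
Variables (I : finType) (F : realFieldType).
Notation cube := {ffun I -> bool}.
Implicit Types (x : cube) (P Q : cube -> bool).


Definition shift (V : {fset F}) (b : F) : {fset F} := [fset (v - b)%R | v in V]%fset.

Lemma in_shift V b y : (y \in shift V b) = (y + b \in V).
Proof.
apply/imfsetP/idP => [[v /= vV ->]|yb]; first by rewrite subrK.
by exists (y + b) => //; rewrite addrK.
Qed.

Lemma card_shift V b : #|` shift V b| = #|` V|.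
Proof. by rewrite card_imfset //= => y z /addIr. Qed.

Lemma sum_shift V b : \sum_(v <- shift V b) v = \sum_(v <- V) v - b *+ #|` V|.
Proof.
rewrite big_imfset /=; last by move=> y z _ _ /addIr.
by rewrite big_split /= big_const_seq count_predT iter_addr addr0 mulNrn.
Qed.

(** Otherwise the two translates would coincide, and so would the sums of their elements; but these
    differ by [2 b] times the cardinality of [V]. *)
Lemma shift_fsetI_lt (V : {fset F}) (b : F) : b != 0 -> (0 < #|` V|)%N ->
  (#|` shift V b `&` shift V (- b)|%fset < #|` V|)%N.
Proof.
move=> b0 V0; rewrite ltnNge; apply/negP => le.
have AB : (shift V b `&` shift V (- b) = shift V b)%fset.
  by apply/eqP; rewrite eqEfcard fsubsetIl /= card_shift.
have BA : (shift V b `&` shift V (- b) = shift V (- b))%fset.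
  by apply/eqP; rewrite eqEfcard fsubsetIr /= card_shift.
have : \sum_(v <- shift V b) v = \sum_(v <- shift V (- b)) v by rewrite -AB BA.
rewrite !sum_shift => /addrI /eqP.
rewrite eqr_opp mulNrn -subr_eq0 opprK -mulr2n -mulrnA mulrn_eq0 (negbTE b0).
by rewrite muln_eq0 orbF; case: #|` V| V0.
Qed.

(* The Littlewood-Offord bound, with the recursion of [lo] coming from
   [#|A| + #|B| = #|A :|: B| + #|A :&: B|] for the translates [A = V - b] and
   [B = V + b], whose intersection is smaller than [V]. *)
Lemma littlewood_offord (U : seq I) (l : I -> F) (V : {fset F}) Q :
  uniq U -> {in U, forall u, l u != 0 /\ invariant_at u Q} ->
  dens (fun x => Q x && (dot l x \in V)) * 2 ^+ size U
    <= (lo (size U) #|` V|)%:R * dens Q.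
Proof.
elim: U l V => [|u U IH] l V /=.
  move=> _ _; rewrite mulr1; case: (posnP #|` V|) => [/eqP|V0].
    rewrite cardfs_eq0 => /eqP->; rewrite dens_false ?cardfs0 ?mul0r //.
    by move=> x; rewrite inE andbF.
  by rewrite mul1r dens_le // => x /andP[].
move=> /andP[uU Uu] lU; have [lu Qu] := lU _ (mem_head _ _).
have lU' (W : {fset F}) := IH (clear u l) W Uu.
have {}lU' W : dens (fun x => Q x && (dot (clear u l) x \in W)) * 2 ^+ size U
    <= (lo (size U) #|` W|)%:R * dens Q.
  apply: lU' => w wU; have [|lw Qw] := lU w; first by rewrite inE wU orbT.
  by split => //; rewrite /clear; case: (eqVneq w u) wU => // ->; rewrite (negbTE uU).
have [/eqP|V0] := posnP #|` V|.
  rewrite cardfs_eq0 => /eqP->; rewrite dens_false ?mul0r ?mulr_ge0 ?ler0n ?dens_ge0 //.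
  by move=> x; rewrite inE andbF.
rewrite exprS mulrA [_ * 2]mulrC (dens_split _ (fun y => y \in V) Qu).
set A := shift V (l u); set B := shift V (- l u).
rewrite (@dens_add _ _ _ (fun x => Q x && (dot (clear u l) x \in (A `|` B)%fset))
                         (fun x => Q x && (dot (clear u l) x \in (A `&` B)%fset))); last first.
  move=> x; rewrite in_fsetU in_fsetI !in_shift.
  by case: (Q x); case: (_ + l u \in V); case: (_ - l u \in V).
rewrite mulrDl; apply: le_trans (lerD (lU' _) (lU' _)) _.
rewrite -mulrDl -natrD ler_wpM2r ?dens_ge0 // ler_nat.
have lt := shift_fsetI_lt lu V0; rewrite -/A -/B in lt.
have := cardfsU A B; have := fsubset_leq_card (fsubsetIl A B).
rewrite !card_shift => le ->.
move: lt le; move: #|` V| #|` A `&` B|%fset V0 => [//|v] w _.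
rewrite ltnS => wv _ /=.
(* Union and intersection have sizes with sum [2 v + 2], the smaller being [w <= v]; [lo_spread]
   moves these sizes to [v + 2] and [v]. *)
have -> : (v.+1 + v.+1 - w = (w + (v - w) + (v - w)).+2)%N by lia.
by apply: leq_trans (lo_spread _ _ _) _; rewrite subnKC.
Qed.

End LittlewoodOfford.

(** * Systems of rows *)

Section Rows.
Variables (I : finType) (F : realFieldType).
Notation cube := {ffun I -> bool}.
Notation row := {ffun I -> F}.
Implicit Types (x : cube) (P Q : cube -> bool) (l : row) (L : seq row) (W : {set I}).

Definition pm1 (R : pzRingType) (y : R) := (y == 1) || (y == -1).

Lemma pm1N (R : pzRingType) (y : R) : pm1 (- y) = pm1 y.
Proof. by rewrite /pm1 !eqr_oppLR opprK orbC. Qed.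

Definition sat l x := pm1 (dot l x).
Definition Sat L x := all (sat^~ x) L.
Definition supp l := [set i | l i != 0].
Definition trivial_row l := [forall x, sat l x].

Lemma suppN l i : i \notin supp l -> l i = 0.
Proof. by rewrite inE negbK => /eqP. Qed.

Lemma sat_neg l x : sat l [ffun i => ~~ x i] = sat l x.
Proof. by rewrite /sat dot_neg pm1N. Qed.

Lemma sat_invariant l u : u \notin supp l -> invariant_at u (sat l).
Proof. by move=> /suppN lu x; rewrite /sat dot_flip0. Qed.

Lemma Sat_invariant L u : {in L, forall l, trivial_row l || (u \notin supp l)} ->
  invariant_at u (Sat L).
Proof.
move=> LW x; apply: eq_in_all => l /LW/orP[/forallP tl|/sat_invariant->//].
by rewrite !tl.
Qed.

Lemma Sat_le L l : l \in L -> dens (Sat L) <= dens (sat l).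
Proof. by move=> lL; apply: dens_le => x /allP/(_ l lL). Qed.

Definition fset_pm1 : {fset F} := [fset (1 : F); -1]%fset.

Lemma card_pm1 : #|` fset_pm1| = 2%N.
Proof. by rewrite cardfs2 -subr_eq0 opprK -(natrD _ 1 1) pnatr_eq0. Qed.

(* The spins of [l] outside [W] are independent of [Q]. *)
Lemma dens_satI_le n W Q l : (n <= #|supp l :\: W|)%N ->
  (forall u, u \notin W -> invariant_at u Q) ->
  dens (fun x => Q x && sat l x) * 2 ^+ n <= (lo n 2)%:R * dens Q.
Proof.
move=> le QW; pose U := take n (enum (supp l :\: W)).
have szU : size U = n by rewrite size_takel // -cardE.
have := @littlewood_offord I F U l fset_pm1 Q; rewrite szU card_pm1 => LO.
apply: le_trans (LO _ _).
- rewrite ler_wpM2r ?exprn_ge0 // dens_le // => x.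
  by rewrite /sat /pm1 !inE.
- by rewrite take_uniq ?enum_uniq.
- by move=> u /mem_take; rewrite mem_enum !inE => /andP[/QW].
Qed.

Lemma dens_sat_le n l : (n <= #|supp l|)%N -> dens (sat l) * 2 ^+ n <= (lo n 2)%:R.
Proof.
move=> le; have := @dens_satI_le n set0 predT l.
by rewrite setD0 (@dens_true I predT) // mulr1; apply.
Qed.

(** With [b = l u], the two values of the spin [u] leave the targets [1 - b], [-1 - b] and [1 + b],
    [-1 + b] for the other terms. As [b] is not 0, 1 or -1, the two pairs are disjoint, so twice the
    density counts a single set of at most four targets. *)
Lemma dens_sat_non_unit n l u : u \in supp l -> ~~ pm1 (l u) -> (n < #|supp l|)%N ->
  dens (sat l) * 2 ^+ n.+1 <= (lo n 4)%:R.
Proof.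
rewrite inE => lu nlu le.
have split2 := @dens_split I F u l predT (@pm1 F) (fun=> erefl).
pose V : {fset F} := [fset (1 - l u)%R; (-1 - l u)%R; (1 + l u)%R; (-1 + l u)%R]%fset.
have cardV : (#|` V| <= 4)%N.
  by rewrite /V !cardfsU !cardfs1; lia.
pose U := take n (enum (supp l :\ u)).
have szU : size U = n.
  by rewrite size_takel // -cardE; have := cardsD1 u (supp l); rewrite inE lu; lia.
have inU w : w \in U -> l w != 0 /\ w != u.
  by move=> /mem_take; rewrite mem_enum !inE => /andP[].
have := @littlewood_offord I F U (clear u l) V predT.
rewrite szU (@dens_true I predT) // mulr1 => LO.
apply: (@le_trans _ _ (lo n #|` V|)%:R); last by rewrite ler_nat lo_mono.
apply: le_trans (LO _ _).
- rewrite exprS mulrA ler_wpM2r ?exprn_ge0 // mulrC split2.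
  rewrite -[leRHS]addr0 -(@dens_false I (fun=> false)) //.
  rewrite le_eqVlt; apply/orP; left; apply/eqP; apply: dens_add => x /=.
  rewrite addn0 /V !inE /pm1; set d := dot _ x; set b := l u in lu nlu *.
  have dbE c : (d + b == c) = (d == c - b) by rewrite -[in LHS](opprK b) subr_eq.
  rewrite !dbE !subr_eq; move: nlu; rewrite /pm1 negb_or => /andP[/eqP b1 /eqP b2].
  have : ~~ (((d == 1 - b) || (d == -1 - b)) && ((d == 1 + b) || (d == -1 + b))).
    apply/negP => /andP[/orP[]/eqP e1 /orP[]/eqP e2];
      first [by apply: b1; lra | by apply: b2; lra | by move/eqP: lu; apply; lra].
  by move: (_ == _) (_ == _) (_ == _) (_ == _) => [] [] [] [].
- by rewrite take_uniq ?enum_uniq.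
- by move=> w /inU[lw wu]; rewrite /clear (negbTE wu).
Qed.

Lemma card_half P w : (forall x, P [ffun i => ~~ x i] = P x) ->
  #|[pred x | P x]| = (2 * #|[pred x | P x && ~~ x w]|)%N.
Proof.
move=> Pn; have nK : involutive (fun x : cube => [ffun i => ~~ x i]).
  by move=> x; apply/ffunP => i; rewrite !ffunE negbK.
rewrite !cardP mul2n -addnn [in X in (_ = _ + X)%N](reindex_inj (inv_inj nK)).
rewrite -big_split; apply: eq_bigr => x _ /=; rewrite Pn ffunE negbK.
by case: (P x) (x w) => [] [].
Qed.

(** Fixing the spin [u] to [false] costs a factor 2 and keeps the invariance at the other spins. *)
Lemma dvdn_invariant (U : seq I) P : uniq U -> {in U, forall u, invariant_at u P} ->
  (2 ^ size U %| #|[pred x | P x]|)%N.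
Proof.
elim: U P => [|u U IH] P /=; first by rewrite dvd1n.
move=> /andP[uU Uu] PU.
have -> : #|[pred x | P x]| = (2 * #|[pred x | P x && ~~ x u]|)%N.
  rewrite !cardP mul2n -addnn [in X in (_ = _ + X)%N](reindex_inj (inv_inj (flipK u))).
  rewrite -big_split; apply: eq_bigr => x _ /=.
  rewrite PU ?mem_head // ffunE eqxx negbK.
  by case: (P x) (x u) => [] [].
rewrite expnS dvdn_pmul2l //; apply: IH => // w wU x.
rewrite PU ?inE ?wU ?orbT // ffunE.
by case: eqP wU uU => // -> ->.
Qed.

(* The extra factor [2] comes from the symmetry [x -> -x]. *)
Lemma dens_Sat_dyadic n L W : {in L, forall l, trivial_row l || (supp l \subset W)} ->
  (#|W| <= n.+1)%N -> exists c : nat, dens (Sat L) * 2 ^+ n = c%:R.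
Proof.
move=> LW Wn.
suff /dvdnP[c e] : (2 ^ #|I| %| #|[pred x | Sat L x]| * 2 ^ n)%N.
  exists c; rewrite /dens mulrAC -natrX -natrM e natrM natrX mulfK //.
  by rewrite lt0r_neq0 ?pow2_gt0.
have inv u : u \notin W -> invariant_at u (Sat L).
  move=> uW; apply: Sat_invariant => l /LW/orP[->//|/subsetP lW].
  by apply/orP; right; apply: contra uW; apply: lW.
have sz : size (enum (~: W)) = (#|I| - #|W|)%N by rewrite -cardE cardsCs setCK.
have WI : (#|W| <= #|I|)%N by apply: max_card.
(* Each spin outside [W] gives a factor 2, and the global sign change gives one more through a spin
   [w] of [W]. An empty [W] does not need the latter. *)
case: (set_0Vmem W) => [W0|[w wW]].
  apply: dvdn_mulr; have := @dvdn_invariant (enum (~: W)) (Sat L) (enum_uniq _).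
  rewrite sz W0 cards0 subn0; apply => u; rewrite mem_enum inE -W0; exact: inv.
rewrite (@card_half (Sat L) w) => [|x]; last by apply: eq_all => l; rewrite sat_neg.
apply: (@dvdn_trans (2 ^ (1 + (#|I| - #|W|) + n))); first by apply: dvdn_exp2l; lia.
rewrite expnD dvdn_mul // expnD expn1 dvdn_mul // -sz.
apply: dvdn_invariant; first exact: enum_uniq.
move=> u; rewrite mem_enum inE => uW x; rewrite inv // ffunE.
by case: eqP uW wW => // -> /negbTE->.
Qed.
End Rows.

(** * Bounds for single rows and pairs of rows *)

Section RowCases.
Variables (I : finType) (F : realFieldType).
Notation cube := {ffun I -> bool}.
Notation row := {ffun I -> F}.
Implicit Types (x : cube) (P Q : cube -> bool) (l : row) (L : seq row) (W : {set I}).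

(** For densities that are multiples of a power of 1/2, this turns a strict inequality into a gap of
    one full step. *)
Lemma ltr_natS_le (c n : nat) : (c%:R : rat) < n.+1%:R -> (c%:R : rat) <= n%:R.
Proof. by rewrite ltr_nat ler_nat ltnS. Qed.

Lemma trivialP l : reflect (forall x, sat l x) (trivial_row l).
Proof. exact: forallP. Qed.

Lemma not_trivialP l : ~~ trivial_row l -> exists x, ~~ sat l x.
Proof. by rewrite negb_forall => /existsP. Qed.

Lemma dens_sat_dyadic n l : (#|supp l| <= n.+1)%N ->
  exists c : nat, dens (sat l) * 2 ^+ n = c%:R.
Proof.
move=> le; have [|c e] := @dens_Sat_dyadic I F n [:: l] (supp l) _ le.
  by move=> l' /[1!inE]/eqP->; rewrite subxx orbT.
by exists c; rewrite -e; congr (_ * _); apply: eq_dens => x; rewrite /Sat /= andbT.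
Qed.

Lemma nontrivial_lt1 l : ~~ trivial_row l -> dens (sat l) < 1.
Proof.
move=> /not_trivialP[x nx]; rewrite -(@dens_true I predT) //.
exact: (dens_lt (x := x)).
Qed.

Lemma nontrivial_small l : (#|supp l| <= 2)%N -> ~~ trivial_row l ->
  dens (sat l) <= 1 / 2.
Proof.
move=> le /nontrivial_lt1; have [c] := dens_sat_dyadic le; rewrite expr1 => e lt.
by have := @ltr_natS_le c 1; lra.
Qed.

Lemma nontrivial_le l : ~~ trivial_row l -> dens (sat l) <= 3 / 4.
Proof.
move=> nt; case: (leqP #|supp l| 2) => [le|lt].
  by have := nontrivial_small le nt; lra.
have := @dens_sat_le I F 3 l lt; have -> : lo 3 2 = 6%N by []; lra.
Qed.

(** No entry gives density 0, and two or more give at most 3/4 by Littlewood-Offord. *)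
Lemma trivial_supp l : trivial_row l -> #|supp l| = 1%N.
Proof.
move=> tl; have d1 : dens (sat l) = 1 by apply/dens_true/trivialP.
case: (posnP #|supp l|) => [/eqP|lt0].
  rewrite cards_eq0 => /eqP s0; exfalso; suff : dens (sat l) = 0 by lra.
  apply: dens_false => x; rewrite /sat /dot big1 => [|i _].
    by rewrite /pm1 ![0 == _]eq_sym oppr_eq0 oner_eq0.
  by rewrite (@suppN I F l i) ?s0 ?inE // oppr0 if_same.
apply/eqP; rewrite eqn_leq lt0 andbT leqNgt; apply/negP => lt1.
exfalso; have := @dens_sat_le I F 2 l lt1; have -> : lo 2 2 = 3%N by []; lra.
Qed.

Lemma nontrivial_cases l : ~~ trivial_row l ->
  #|supp l| = 3%N \/ dens (sat l) <= 5 / 8.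
Proof.
move=> nt; case: (ltngtP #|supp l| 3) => [le|lt|]; [right|right|by left].
  by have := nontrivial_small le nt; lra.
have := @dens_sat_le I F 4 l lt; have -> : lo 4 2 = 10%N by []; lra.
Qed.

Definition unit_row l := [forall u in supp l, pm1 (l u)].

(** Parity: [dot l x] is the size of the support minus twice the number of negative terms. *)
Lemma unit_row_even l : unit_row l -> ~~ odd #|supp l| -> dens (sat l) = 0.
Proof.
move=> /forall_inP ul ev; apply: dens_false => x.
pose b i := x i (+) (l i == -1).
have e : dot l x = #|supp l|%:R - 2 * (\sum_(i in supp l) b i)%:R.
  rewrite /dot (bigID (mem (supp l))) /= [X in _ + X]big1 ?addr0 => [|i /suppN->].
    rewrite -sum1_card !natr_sum mulr_sumr -sumrB; apply: eq_bigr => i /ul.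
    have n11 : ((1 : F) == -1) = false by apply/eqP => h; lra.
    by rewrite /b; case/orP=> /eqP->; rewrite ?n11 ?eqxx; case: (x i) => /=; lra.
  by rewrite oppr0 if_same.
have [h eh] : exists h, #|supp l| = (2 * h)%N.
  by exists #|supp l|./2; have := odd_double_half #|supp l|; lia.
rewrite /sat e eh; set m := (\sum_(_ in _) _)%N.
apply/negP => /orP[]/eqP e'.
  have : (2 * h)%:R = (2 * m + 1)%:R :> F by rewrite natrD natrM; lra.
  by move/eqP; rewrite eqr_nat => /eqP; lia.
have : (2 * h + 1)%:R = (2 * m)%:R :> F by rewrite natrD natrM; lra.
by move/eqP; rewrite eqr_nat => /eqP; lia.
Qed.

(** Unit rows are cut off at eleven entries, where the bound is 924/2048. For the other rows the
    bound is 4/8 from three entries on and 30/64 = 15/32 from six on. *)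
Lemma row_cases l : [\/ trivial_row l, dens (sat l) <= 1 / 2 /\ (#|supp l| <= 5)%N,
  dens (sat l) <= 15 / 32 | unit_row l /\ #|supp l| \in [:: 3; 5; 7; 9]%N].
Proof.
case: (boolP (trivial_row l)) => [|nt]; first by constructor 1.
case: (boolP (unit_row l)) => [ul|].
  case: (boolP (odd #|supp l|)) => [od|/(unit_row_even ul) d0]; last by constructor 3; lra.
  case: (leqP #|supp l| 2) => [le|gt2].
    by constructor 2; split; [apply: nontrivial_small|lia].
  case: (leqP 11 #|supp l|) => [gt10|lt11].
    by constructor 3; have := @dens_sat_le I F 11 l gt10; have -> : lo 11 2 = 924%N by []; lra.
  constructor 4; split=> //; move: od gt2 lt11.
  by move: #|supp l|; do 11!case=> //.
rewrite negb_forall => /existsP[u]; rewrite negb_imply => /andP[us nu].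
case: (leqP #|supp l| 5) => [le|gt5].
  constructor 2; split=> //; case: (leqP #|supp l| 2) => [?|gt2]; first exact: nontrivial_small.
  have := @dens_sat_non_unit I F 2 l u us nu gt2; have -> : lo 2 4 = 4%N by []; lra.
constructor 3; have := @dens_sat_non_unit I F 5 l u us nu gt5.
have -> : lo 5 4 = 30%N by []; lra.
Qed.

(** Reduction from lists to pairs: a solution of [l] that violates the system violates some
    particular row, which then cuts strictly. *)
Lemma Sat_cut L l : l \in L -> Sat L =1 sat l \/
  exists l2, [/\ l2 \in L, ~~ trivial_row l2, dens (Sat L) <= dens (Sat [:: l; l2])
    & dens (Sat [:: l; l2]) < dens (sat l)].
Proof.
move=> lL; case: (boolP [forall x, sat l x ==> Sat L x]) => [/forallP h|].
  left=> x; apply/idP/idP; first by move/allP/(_ l lL).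
  by have := h x; case: (sat l x).
rewrite negb_forall => /existsP[x]; rewrite negb_imply => /andP[lx].
rewrite -has_predC => /hasP[l2 l2L /= nl2]; right; exists l2; split=> //.
- by apply/negP => /trivialP/(_ x); apply/negP.
- by apply: dens_le => y /allP Ly; rewrite /Sat /= !Ly.
- apply: (dens_lt (x := x)) => //; first by move=> y /andP[].
  by rewrite /Sat /= (negbTE nl2) andbF.
Qed.

Lemma dens_Sat2_le n l l2 : (n <= #|supp l2 :\: supp l|)%N ->
  dens (Sat [:: l; l2]) * 2 ^+ n <= (lo n 2)%:R * dens (sat l).
Proof.
move=> le; apply: le_trans (@dens_satI_le I F n (supp l) (sat l) l2 le _); last first.
  by move=> u; apply: sat_invariant.
by rewrite ler_wpM2r ?exprn_ge0 // dens_le // => x; rewrite /Sat /= andbT.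
Qed.

Lemma dens_Sat2_far l l2 : (1 < #|supp l2 :\: supp l|)%N ->
  dens (Sat [:: l; l2]) <= 3 / 4 * dens (sat l).
Proof.
by move=> /dens_Sat2_le; have -> : lo 2 2 = 3%N by []; lra.
Qed.

Lemma card_suppU l l2 :
  #|supp l :|: supp l2| = (#|supp l| + #|supp l2 :\: supp l|)%N.
Proof. by rewrite cardsU -(cardsID (supp l) (supp l2)) setIC; lia. Qed.

Lemma dens_Sat2_dyadic n l l2 : (#|supp l :|: supp l2| <= n.+1)%N ->
  exists c : nat, dens (Sat [:: l; l2]) * 2 ^+ n = c%:R.
Proof.
by apply: dens_Sat_dyadic => l' /[!inE]/orP[]/eqP->; rewrite ?subsetUl ?subsetUr orbT.
Qed.

(** Alone, the row has a density in sixteenths. A cutting row either brings two new spins and leaves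
    at most 3/8, or there are at most six spins in all, and a multiple of 1/32 below 1/2 is at most
    15/32. *)
Lemma half_row L l : l \in L -> (#|supp l| <= 5)%N -> dens (sat l) <= 1 / 2 ->
  dens (Sat L) <= 15 / 32 \/ dens (Sat L) = 1 / 2.
Proof.
move=> lL l5 d2.
case: (Sat_cut lL) => [/eq_dens->|[l2 [_ _ le lt]]].
  have [c e] := dens_sat_dyadic l5.
  case: (ltP (dens (sat l)) (1 / 2)) => ?; last by right; lra.
  by left; have := @ltr_natS_le c 7; lra.
left; apply: le_trans le _.
case: (leqP #|supp l2 :\: supp l| 1) => [le1|/dens_Sat2_far]; last by lra.
have [|c e] := @dens_Sat2_dyadic 5 l l2; first by rewrite card_suppU; lia.
by have := @ltr_natS_le c 15; lra.
Qed.

(** The pattern of [half_row] one level up: above 5/8 a nontrivial row has three entries and density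
    3/4. A cutting row leaves at most 9/16, or a multiple of 1/8 below 3/4 on at most four spins. *)
Lemma Sat_cases L : [\/ {in L, forall l, trivial_row l},
  exists l, [/\ l \in L, #|supp l| = 3%N, Sat L =1 sat l & dens (Sat L) = 3 / 4]
  | dens (Sat L) <= 5 / 8].
Proof.
case: (boolP (all (@trivial_row I F) L)) => [/allP|]; first by constructor 1.
rewrite -has_predC => /hasP[l lL /= nt].
case: (lerP (dens (Sat L)) (5 / 8)) => [?|gt]; first by constructor 3.
have supp3 l' : l' \in L -> ~~ trivial_row l' -> #|supp l'| = 3%N.
  by move=> /Sat_le ? /nontrivial_cases[//|?]; exfalso; lra.
have l3 := supp3 l lL nt; have l34 := nontrivial_le nt.
have [|c e] := @dens_sat_dyadic 2 l; first by rewrite l3.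
have cle : (c%:R : rat) <= 3%:R by lra.
have cgt : (2%:R : rat) < c%:R by have := Sat_le lL; lra.
have {}e : dens (sat l) = 3 / 4.
  have c3 : c = 3%N by move: cle cgt; rewrite ler_nat ltr_nat; lia.
  by rewrite c3 in e; lra.
case: (Sat_cut lL) => [eL|[l2 [l2L nt2 le lt]]].
  by constructor 2; exists l; split=> //; rewrite (eq_dens eL).
case: (leqP #|supp l2 :\: supp l| 1) => [le1|/dens_Sat2_far]; last by lra.
have [|d f] := @dens_Sat2_dyadic 3 l l2; first by rewrite card_suppU l3; clear -le1; lia.
by have := @ltr_natS_le d 5; lra.
Qed.

(** Flipping a spin [u] of [l2] outside [l] preserves [sat l], so wherever [l] holds the other terms
    of [l2] sum to 0. With a second spin in [l2] this has density at most 1/2; without one, [l2] is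
    trivial. *)
Lemma sat_sub_supp l l2 : (forall x, sat l x -> sat l2 x) -> 1 / 2 < dens (sat l) ->
  trivial_row l2 || (supp l2 \subset supp l).
Proof.
move=> sub d2; case: (boolP (_ \subset _)) => [|/subsetPn[u ul2 ul]]; first by rewrite orbT.
rewrite orbF.
have l2u : l2 u != 0 by rewrite inE in ul2.
have dot0 x : sat l x -> dot (clear u l2) x = 0.
  move=> lx; have := sub _ lx; have := sub (flip u x).
  rewrite (sat_invariant ul) lx => /(_ isT); rewrite /sat dot_flip [dot l2 x](dot_clear u).
  set d := dot _ _; set b := l2 u in l2u *; move: l2u => /eqP b0.
  case: (x u) => /orP[]/eqP h1 /orP[]/eqP h2; try lra;
    by exfalso; apply: b0; lra.
have [x lx] : exists x, sat l x.
  case: (pickP (sat l)) => [x lx|h]; first by exists x.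
  by exfalso; have := @dens_false I (sat l) (fun x => negbT (h x)); lra.
case: (boolP [exists w in supp l2, w != u]) => [/exists_inP[w wl2 wu]|].
  have := @littlewood_offord I F [:: w] (clear u l2) [fset 0]%fset predT isT.
  rewrite /= cardfs1 (@dens_true I predT) // mulr1 => LO.
  suff : dens (sat l) * 2 ^+ 1 <= (lo 1 1)%:R by have -> : lo 1 1 = 1%N by []; lra.
  apply: le_trans (LO _).
    by rewrite ler_wpM2r ?exprn_ge0 // dens_le // => y /dot0->; rewrite inE.
  by move=> v /[1!inE]/eqP->; rewrite /clear (negbTE wu); rewrite inE in wl2.
rewrite negb_exists => /forallP nw; apply/trivialP => y.
have {dot0} c0 z : dot (clear u l2) z = 0.
  rewrite /dot big1 // => i _; rewrite /clear; case: eqP => [_|/eqP iu].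
    by rewrite oppr0 if_same.
  have := nw i; rewrite negb_and iu orbF => /suppN->; by rewrite oppr0 if_same.
have := sub _ lx; rewrite /sat [dot l2 x](dot_clear u) [dot l2 y](dot_clear u) !c0 !add0r.
by case: (x u); case: (y u); rewrite ?pm1N.
Qed.

(* A nontrivial row [l] with support [{u}] or [{a, u}] cannot be satisfied at
   both [x] and [flip u x]. *)
Lemma dens_pair_le a u l Q : ~~ trivial_row l -> supp l \subset [set a; u] ->
  u \in supp l -> u != a -> invariant_at u Q ->
  2 * dens (fun x => Q x && sat l x) <= dens Q.
Proof.
move=> nt /subsetP sl; rewrite inE => lu ua Qu.
rewrite (@dens_split I F u l Q (@pm1 F)) //.
rewrite -[leRHS]addr0 -(@dens_false I (fun=> false)) //.
have c0 x : dot (clear u l) x = if x a then - l a else l a.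
  rewrite (dot_clear a) /dot big1 ?add0r => [|i _]; first by rewrite /clear eq_sym (negbTE ua).
  rewrite /clear; case: eqP => [_|/eqP ia]; first by rewrite oppr0 if_same.
  case: eqP => [_|/eqP iu]; first by rewrite oppr0 if_same.
  rewrite (@suppN I F l i) ?oppr0 ?if_same //; apply/negP => /sl.
  by rewrite !inE (negbTE ia) (negbTE iu).
rewrite (@dens_add _ _ _ (fun x => Q x && (pm1 (dot (clear u l) x + l u)
  || pm1 (dot (clear u l) x - l u))) (fun=> false)).
  by rewrite lerD // dens_le // => x /andP[].
move=> x; case: (Q x) => //=.
suff : ~~ (pm1 (dot (clear u l) x + l u) && pm1 (dot (clear u l) x - l u)).
  by case: (pm1 _); case: (pm1 _).
apply/negP => /andP[]; rewrite c0; case/not_trivialP: nt => y.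
rewrite /sat (dot_clear u) c0; move/eqP: lu; set b := l u; set d := l a => b0 ny.
move=> h1 h2; have d0 : d = 0.
  by move: h1 h2; case: (x a) => /orP[]/eqP h1 /orP[]/eqP h2; try lra;
    exfalso; apply: b0; lra.
move: h1 ny; rewrite d0 oppr0 !if_same !add0r => pb.
by case: (y u); rewrite ?pm1N pb.
Qed.

End RowCases.

(** * Rows with three entries: merging spins *)

Section Merge.
Variables (I : finType) (F : realFieldType).
Notation cube := {ffun I -> bool}.
Notation row := {ffun I -> F}.
Implicit Types (x : cube) (P Q : cube -> bool) (l : row) (L : seq row) (W : {set I}).

Lemma card_suppU_pinned a l l2 : (#|supp l :\ a| <= 1)%N -> (#|supp l2 :\ a| <= 1)%N ->
  (#|supp l :|: supp l2| <= 3)%N.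
Proof.
move=> l1 l21; apply: (@leq_trans #|a |: ((supp l :\ a) :|: (supp l2 :\ a))|).
  apply/subset_leq_card/subsetP => i; rewrite !inE.
  by case: (i == a).
by rewrite cardsU1 cardsU; lia.
Qed.

Lemma card_supp_pinned a l : (#|supp l :\ a| <= 1)%N -> (#|supp l| <= 2)%N.
Proof. by rewrite (cardsD1 a (supp l)); lia. Qed.

(** For use with [a] a merged spin. A nontrivial row has at most two spins, hence density 0 or 1/2;
    two such rows have at most three spins, so a proper cut falls to a multiple of 1/4 below 1/2. *)
Lemma Sat_pairs a L : {in L, forall l, trivial_row l || (#|supp l :\ a| <= 1)%N} ->
  [\/ dens (Sat L) = 1, dens (Sat L) = 1 / 2 | dens (Sat L) <= 1 / 4].
Proof.
move=> La; case: (boolP (all (@trivial_row I F) L)) => [/allP tL|].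
  by constructor 1; apply: dens_true => x; apply/allP => l /tL/trivialP.
rewrite -has_predC => /hasP[l lL /= nt].
have := La _ lL; rewrite (negbTE nt) /= => l1.
have l2 := card_supp_pinned l1; have dl := nontrivial_small l2 nt.
case: (Sat_cut lL) => [/eq_dens->|[l' [l'L nt' le lt]]].
  have [c e] := dens_sat_dyadic l2; case: (ltP (dens (sat l)) (1 / 2)) => ?.
    by constructor 3; have := @ltr_natS_le c 0; lra.
  by constructor 2; lra.
have := La _ l'L; rewrite (negbTE nt') /= => l'1.
have [c e] := dens_Sat2_dyadic (card_suppU_pinned l1 l'1).
by constructor 3; have := @ltr_natS_le c 1; lra.
Qed.

(** If some nontrivial row is not supported in [W], it lies in [[set a; u]] with [u] outside [W] and
    has density 0 or 1/2. A cutting row inside [W] is independent of [u], so [dens_pair_le] halves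
    its density, which is at most 3/4; any other cutting row leaves at most 1/4. *)
Lemma Sat_block a W L : a \in W -> (#|W| <= 4)%N ->
  {in L, forall l, [|| trivial_row l, supp l \subset W | (#|supp l :\ a| <= 1)%N]} ->
  dens (Sat L) <= 3 / 8 \/ exists c : nat, dens (Sat L) * 8 = c%:R.
Proof.
move=> aW W4 LW.
case: (boolP (all (fun l => trivial_row l || (supp l \subset W)) L)) => [/allP tL|].
  by right; have [c e] := dens_Sat_dyadic tL W4; exists c; rewrite -e; lra.
rewrite -has_predC => /hasP[l lL /=]; rewrite negb_or => /andP[nt nW].
have := LW _ lL; rewrite (negbTE nt) (negbTE nW) /= => l1.
have l2 := card_supp_pinned l1; have dl := nontrivial_small l2 nt.
case: (Sat_cut lL) => [/eq_dens->|[l' [l'L nt' le lt]]].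
  have [c e] := dens_sat_dyadic l2; right; exists (4 * c)%N.
  by rewrite natrM -e; lra.
left; apply: le_trans le _.
have := LW _ l'L; rewrite (negbTE nt') /= => /orP[l'W|l'1]; last first.
  have [c e] := dens_Sat2_dyadic (card_suppU_pinned l1 l'1).
  by have := @ltr_natS_le c 1; lra.
have [u ul uW] := subsetPn nW.
have ua : u != a by apply: contraNneq uW => ->.
have lau : supp l \subset [set a; u].
  apply/subsetP => i il; rewrite !inE; case: eqP => //= /eqP ia.
  by apply/eqP/(card_le1_eqP l1); rewrite !inE ?ia ?ua //; move: il ul; rewrite !inE.
have := @dens_pair_le I F a u l (sat l') nt lau ul ua.
have inv : invariant_at u (sat l').
  by apply: sat_invariant; apply: contra uW; apply: (subsetP l'W).
move=> /(_ inv); rewrite (@eq_dens _ _ (Sat [:: l; l'])) => [|x].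
  by have := nontrivial_le nt'; lra.
by rewrite /Sat /= andbT andbC.
Qed.

(** The spin [b] is identified with that of [a], or with its opposite if [e] holds. The index type
    is kept: [b] becomes a free spin, which does not affect densities. *)
Definition merge a b (e : bool) l : row :=
  [ffun i => if i == b then 0 else
             if i == a then l a + (if e then - l b else l b) else l i].

Definition copy a b (e : bool) x : cube := [ffun i => if i == b then x a (+) e else x i].

Lemma dot_merge a b e l x : a != b -> dot (merge a b e l) x = dot l (copy a b e x).
Proof.
move=> ab; rewrite [RHS](dot_clear b) ffunE eqxx.
have -> : dot (clear b l) (copy a b e x) = dot (clear b l) x.
  apply: eq_dot => i; rewrite /clear ffunE; by case: (i == b); rewrite ?eqxx.
rewrite (dot_clear a) [in RHS](dot_clear a) -addrA; congr (_ + _).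
  apply: eq_bigr => i _; rewrite /clear ffunE.
  by case: (i == a); case: (i == b).
rewrite /clear ffunE eqxx (negbTE ab).
by case: (x a); case: e => /=; rewrite ?opprD ?opprK.
Qed.

Lemma Sat_merge a b e L x : a != b -> Sat (map (merge a b e) L) x = Sat L (copy a b e x).
Proof. by move=> ab; rewrite /Sat all_map; apply: eq_all => l; rewrite /= /sat dot_merge. Qed.

Lemma dens_merge a b L : a != b ->
  2 * dens (Sat L) = dens (Sat (map (merge a b false) L)) + dens (Sat (map (merge a b true) L)).
Proof.
move=> ab; rewrite mulr_natl mulr2n -{2}(dens_bij _ (flipK b)).
apply: dens_add => x /=; rewrite !Sat_merge //.
(* For a given [x], one relative sign reproduces [x] and the other gives [flip b x]. *)
have e1 : copy a b (x a (+) x b) x = x.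
  by apply/ffunP => i; rewrite ffunE addbA addbb; case: eqP => // ->.
have e2 : copy a b (~~ (x a (+) x b)) x = flip b x.
  apply/ffunP => i; rewrite !ffunE addbN addbA addbb.
  by case: eqP => [->|].
by move: e1 e2; case: (x a (+) x b) => /= -> ->; rewrite // addnC.
Qed.

Section Triple.
Variables (a b c : I).
Hypotheses (ab : a != b) (ac : a != c).

Definition merge2 (e e' : bool) l := merge a c e' (merge a b e l).

(** Outside [a] the merged support does not depend on the signs, so what one merged system reveals
    about the rows constrains all four. *)
Lemma supp_merge2 e e' l : supp (merge2 e e' l) :\ a = supp l :\: [set a; b; c].
Proof.
apply/setP => i; rewrite !inE !ffunE.
by case: (eqVneq i a) => //= ia; case: (i == c); case: (i == b); rewrite ?eqxx ?andbF ?orbT.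
Qed.

Lemma dens_merge2 L : 4 * dens (Sat L) =
  dens (Sat (map (merge2 false false) L)) + dens (Sat (map (merge2 false true) L)) +
  (dens (Sat (map (merge2 true false) L)) + dens (Sat (map (merge2 true true) L))).
Proof.
have := dens_merge L ab; have := dens_merge (map (merge a b false) L) ac.
have := dens_merge (map (merge a b true) L) ac.
by rewrite -!map_comp; lra.
Qed.

Lemma merge2_pairs L : {in L, forall l, #|supp l :\: [set a; b; c]| <= 1}%N ->
  forall e e', let d := dens (Sat (map (merge2 e e') L)) in
  [\/ d = 1, d = 1 / 2 | d <= 1 / 4].
Proof.
move=> L1 e e'; apply: (@Sat_pairs a) => l /mapP[l0 l0L ->].
by rewrite supp_merge2 L1 ?orbT.
Qed.

Lemma merge2_block L (T : {set I}) : (#|T| <= 3)%N ->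
  {in L, forall l, (supp l :\: [set a; b; c] \subset T) || (#|supp l :\: [set a; b; c]| <= 1)%N} ->
  forall e e', let d := dens (Sat (map (merge2 e e') L)) in
  d <= 3 / 8 \/ exists n : nat, d * 8 = n%:R.
Proof.
move=> T3 LT e e'; apply: (@Sat_block a (a |: T)); first by rewrite setU11.
  by rewrite cardsU1; lia.
move=> l /mapP[l0 l0L ->]; rewrite supp_merge2.
have /orP[lT|->] := LT _ l0L; last by rewrite !orbT.
apply/orP; right; apply/orP; left; apply/subsetP => i il; rewrite in_setU1.
case: (eqVneq i a) => //= ia; apply: (subsetP lT).
by rewrite -(supp_merge2 e e') in_setD1 ia.
Qed.

End Triple.

(** The bounds are four times 15/32 and 1/2. If one value is 1, the other two sum to a number
    strictly between 7/8 and 1, impossible for values 1, 1/2 or at most 1/4. If the largest is 3/4,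
    a value at most 3/8 keeps the sum within 15/8, and otherwise all are multiples of 1/8. What
    remains is at most three times 5/8. *)
Lemma merge_arith (x1 x2 x3 : rat) :
  [\/ x1 = 1, x1 = 3 / 4 | x1 <= 5 / 8] -> [\/ x2 = 1, x2 = 3 / 4 | x2 <= 5 / 8] ->
  [\/ x3 = 1, x3 = 3 / 4 | x3 <= 5 / 8] ->
  ([\/ x1 = 1, x2 = 1 | x3 = 1] -> [/\ [\/ x1 = 1, x1 = 1 / 2 | x1 <= 1 / 4],
    [\/ x2 = 1, x2 = 1 / 2 | x2 <= 1 / 4] & [\/ x3 = 1, x3 = 1 / 2 | x3 <= 1 / 4]]) ->
  ([\/ x1 = 3 / 4, x2 = 3 / 4 | x3 = 3 / 4] ->
    [/\ x1 <= 3 / 8 \/ exists n : nat, x1 * 8 = n%:R,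
        x2 <= 3 / 8 \/ exists n : nat, x2 * 8 = n%:R
      & x3 <= 3 / 8 \/ exists n : nat, x3 * 8 = n%:R]) ->
  0 <= x1 -> 0 <= x2 -> 0 <= x3 ->
  15 / 8 < x1 + x2 + x3 < 2 -> False.
Proof.
move=> h1 h2 h3 full three p1 p2 p3 /andP[lo up].
have step n1 n2 n3 : x1 * 8 = n1%:R -> x2 * 8 = n2%:R -> x3 * 8 = n3%:R -> False.
  move=> e1 e2 e3; have : (15%:R : rat) < (n1 + n2 + n3)%:R by rewrite !natrD; lra.
  have : ((n1 + n2 + n3)%:R : rat) < 16%:R by rewrite !natrD; lra.
  by rewrite !ltr_nat; lia.
have two (p q : rat) : [\/ p = 1, p = 1 / 2 | p <= 1 / 4] ->
    [\/ q = 1, q = 1 / 2 | q <= 1 / 4] -> 0 <= p -> 0 <= q -> 7 / 8 < p + q -> 1 <= p + q.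
  by clear; case=> ? [?|?|?]; lra.
have nofull : ~ [\/ x1 = 1, x2 = 1 | x3 = 1].
  move=> f; have [f1 f2 f3] := full f.
  case: f => f.
  - by have := two _ _ f2 f3 p2 p3; clear -f lo up => h; have /h : 7 / 8 < x2 + x3; lra.
  - by have := two _ _ f1 f3 p1 p3; clear -f lo up => h; have /h : 7 / 8 < x1 + x3; lra.
  - by have := two _ _ f1 f2 p1 p2; clear -f lo up => h; have /h : 7 / 8 < x1 + x2; lra.
have le34 (p : rat) : p <> 1 -> [\/ p = 1, p = 3 / 4 | p <= 5 / 8] -> p <= 3 / 4.
  by clear => p1 [/p1[]|->|?]; lra.
have le1 := le34 x1 (fun h => nofull (Or31 _ _ h)) h1.
have le2 := le34 x2 (fun h => nofull (Or32 _ _ h)) h2.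
have le3 := le34 x3 (fun h => nofull (Or33 _ _ h)) h3.
have nothree : ~ [\/ x1 = 3 / 4, x2 = 3 / 4 | x3 = 3 / 4].
  move=> t; have [] := three t.
  case=> [?|[n1 e1]]; first by lra.
  case=> [?|[n2 e2]]; first by lra.
  case=> [?|[n3 e3]]; first by lra.
  exact: step e1 e2 e3.
case: h1 => h1; [by apply: nofull; constructor 1|by apply: nothree; constructor 1|].
case: h2 => h2; [by apply: nofull; constructor 2|by apply: nothree; constructor 2|].
case: h3 => h3; [by apply: nofull; constructor 3|by apply: nothree; constructor 3|].
by clear -h1 h2 h3 lo; lra.
Qed.

Lemma card3_set W : #|W| = 3%N ->
  exists a b c, [/\ W = [set a; b; c], a != b, a != c & b != c].
Proof.
rewrite cardE => s3; have := enum_uniq W; have := mem_enum W.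
case: (enum _) s3 => [|a [|b [|c []]]] // _ mem /=; rewrite !inE !negb_or.
move=> /and3P[/andP[ab ac] bc _]; exists a, b, c; split=> //.
by apply/setP => i; have := mem i; rewrite !inE => <-; rewrite orbA.
Qed.

Lemma unit_row3 L l : l \in L -> #|supp l| = 3%N -> unit_row l ->
  dens (Sat L) <= 15 / 32 \/ 1 / 2 <= dens (Sat L).
Proof.
move=> lL l3 ul; case: (lerP (dens (Sat L)) (15 / 32)) => [|lo]; first by left.
right; rewrite leNgt; apply/negP => up.
have [a [b [c [sl ab ac bc]]]] := card3_set l3.
pose x e e' := dens (Sat (map (merge2 a b c e e') L)).
have sum : 4 * dens (Sat L) = x false false + x false true + (x true false + x true true).
  exact: dens_merge2.
have x_ge0 e e' : 0 <= x e e' by apply: dens_ge0.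
(* Aligning the three signed spins turns [l] into a single entry 3 or -3, which is never
   satisfied. *)
have [e0 [e0' x0]] : exists e e', x e e' = 0.
  exists (l b != l a), (l c != l a); apply: dens_false => y.
  have ua i : i \in supp l -> (l i == 1) || (l i == -1) by move/forall_inP: ul => /(_ i).
  have aligned i : i \in supp l -> (if l i != l a then - l i else l i) = l a.
    move=> il; have li := ua _ il; have : a \in supp l by rewrite sl !inE eqxx.
    move=> /ua la; case: (eqVneq (l i) (l a)) => [-> //|]; move: li la; clear => li la.
    by case/orP: la => /eqP->; case/orP: li => /eqP->; rewrite ?opprK ?eqxx.
  have v0 : merge2 a b c (l b != l a) (l c != l a) l a = l a + l a + l a.
    rewrite !ffunE !eqxx (negbTE ab) (negbTE ac) (eq_sym c b) (negbTE bc) (eq_sym c a) (negbTE ac).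
    by rewrite !aligned ?sl ?inE ?eqxx ?orbT.
  apply/negP => /allP/(_ _ (map_f _ lL)); rewrite /sat (dot_clear a) /dot big1 ?add0r => [|i _].
    have := ua a; rewrite v0 sl !inE eqxx => /(_ isT).
    by case/orP => /eqP->; case: (y a) => /orP[] /eqP; lra.
  rewrite /clear; case: eqP => [_|/eqP ia]; first by rewrite oppr0 if_same.
  have : i \notin supp (merge2 a b c (l b != l a) (l c != l a) l) :\ a.
    by rewrite supp_merge2 sl setDv inE.
  by rewrite in_setD1 ia /= => /suppN->; rewrite oppr0 if_same.
have cases e e' : [\/ x e e' = 1, x e e' = 3 / 4 | x e e' <= 5 / 8].
  case: (Sat_cases (map (merge2 a b c e e') L)) => [tr|[n [_ _ _ ?]]|?].
  - by constructor 1; apply: dens_true => y; apply/allP => l' /tr/trivialP.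
  - by constructor 2.
  - by constructor 3.
(* Density 1 makes every merged row trivial, with a single spin, so each row of [L] has at most one
   spin outside the triple. *)
have full e e' : x e e' = 1 -> forall f f', [\/ x f f' = 1, x f f' = 1 / 2 | x f f' <= 1 / 4].
  move=> x1 f f'; apply: merge2_pairs => l' l'L.
  rewrite -(supp_merge2 a b c e e').
  case: (boolP (trivial_row (merge2 a b c e e' l'))) => [/trivial_supp|/nontrivial_lt1].
    by move=> s1; apply: leq_trans (subset_leq_card (subD1set _ _)) _; rewrite s1.
  have := Sat_le (map_f (merge2 a b c e e') l'L); rewrite -/(x e e') x1 => le lt.
  by have := le_lt_trans le lt; rewrite ltxx.
(* Density 3/4 comes from one merged row [n] with three spins that implies all the others, which are
   then trivial or supported in [supp n]. *)
have three e e' : x e e' = 3 / 4 -> forall f f',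
    x f f' <= 3 / 8 \/ exists n : nat, x f f' * 8 = n%:R.
  move=> x34 f f'.
  case: (Sat_cases (map (merge2 a b c e e') L)) => [tr|[n [_ n3 en dn]]|]; last 1 first.
  - by rewrite -/(x e e') x34 => ?; have : (1 : rat) < 0 by lra; rewrite ltr10.
  - suff : x e e' = 1 by rewrite x34 => ?; have : (1 : rat) < 0 by lra; rewrite ltr10.
    by apply: dens_true => y; apply/allP => l' /tr/trivialP.
  apply: (merge2_block ab ac (T := supp n)); first by rewrite n3.
  move=> l' l'L; rewrite -(supp_merge2 a b c e e').
  have /orP[] : trivial_row (merge2 a b c e e' l') || (supp (merge2 a b c e e' l') \subset supp n).
  + apply: sat_sub_supp; last by rewrite -(eq_dens en); lra.
    by move=> y; rewrite -en => /allP; apply; apply: map_f.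
  + move=> /trivial_supp s1; apply/orP; right.
    by apply: leq_trans (subset_leq_card (subD1set _ _)) _; rewrite s1.
  + by move=> s; rewrite (subset_trans (subD1set _ _) s).
have concl e1 e1' e2 e2' e3 e3' : 15 / 8 < x e1 e1' + x e2 e2' + x e3 e3' < 2 -> False.
  apply: (merge_arith (cases _ _) (cases _ _) (cases _ _) _ _
                      (x_ge0 _ _) (x_ge0 _ _) (x_ge0 _ _)).
    by case=> /full h; split; apply: h.
  by case=> /three h; split; apply: h.
case: e0 e0' x0 => [] [] x0.
- by apply: (concl false false false true true false); lra.
- by apply: (concl false false false true true true); lra.
- by apply: (concl false false true false true true); lra.
- by apply: (concl false true true false true true); lra.
Qed.

End Merge.

(** * Exact counts *)

Section ExactCount.
Variables (I : finType) (A : zmodType).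

Fixpoint sign_count (s : seq A) (G : A -> bool) (y : A) : nat :=
  if s is b :: s' then (sign_count s' G (y + b) + sign_count s' G (y - b))%N
  else G y.

Lemma dens_dot_count (U : seq I) (v : I -> A) (G : A -> bool) :
  uniq U -> (forall i, i \notin U -> v i = 0) ->
  dens (fun x => G (dot v x)) * 2 ^+ size U = (sign_count (map v U) G 0)%:R.
Proof.
(* The starting value is generalised so that the induction can accumulate signed entries in it. *)
move=> Uu v0; pose y : A := 0.
have -> : dens (fun x => G (dot v x)) = dens (fun x => G (y + dot v x)).
  by apply: eq_dens => x; rewrite add0r.
rewrite -/y; elim: U v y Uu v0 => [|u U IH] v y /=.
  move=> _ v0; have d0 x : dot v x = 0.
    by rewrite /dot big1 // => i _; rewrite v0 // oppr0 if_same.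
  rewrite mulr1 (eq_dens (Q := fun=> G y)) => [|x]; last by rewrite d0 addr0.
  by case: (G y); [exact: dens_true|exact: dens_false].
move=> /andP[uU Uu] v0.
have eU : map v U = map (clear u v) U.
  by apply/eq_in_map => i iU; rewrite /clear; case: eqP iU uU => // -> ->.
have c0 i : i \notin U -> clear u v i = 0.
  rewrite /clear; case: eqP => // /eqP iu iU; apply: v0.
  by rewrite inE negb_or iu.
rewrite exprS mulrA [_ * 2]mulrC.
rewrite (@dens_split I A u v predT (fun z => G (y + z)) (fun=> erefl)).
rewrite mulrDl natrD eU -!IH //; congr (_ * _ + _ * _); apply: eq_dens => x.
  by rewrite [_ + v u]addrC addrA.
by rewrite [_ - v u]addrC addrA.
Qed.

(** Replacing an entry by its opposite only swaps the two branches of [sign_count]. *)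
Lemma sign_count_block (s t : seq A) e G y :
  {in s, forall b, b = e \/ b = - e} ->
  sign_count (s ++ t) G y = sign_count (nseq (size s) e ++ t) G y.
Proof.
elim: s y => //= b s IH y se.
have se' : {in s, forall b, b = e \/ b = - e} by move=> c cs; apply: se; rewrite inE cs orbT.
by case: (se b (mem_head _ _)) => ->; rewrite !IH // opprK addnC.
Qed.

Lemma sign_count_cat (r s t : seq A) G y :
  (forall z, sign_count s G z = sign_count t G z) ->
  sign_count (r ++ s) G y = sign_count (r ++ t) G y.
Proof. by move=> st; elim: r y => //= b r IH y; rewrite !IH. Qed.

End ExactCount.

Definition pm1_triple (t : int * int * int) := [&& pm1 t.1.1, pm1 t.1.2 & pm1 t.2].

(** The blocks are the spins where two unit rows agree, where they are opposite, and those of the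
    first or second row only. The third coordinate repeats the second row, so that the count for
    three rows also serves pairs. *)
Definition pair_count p q u v : nat :=
  sign_count (nseq p (1, 1, 1) ++ nseq q (1, -1, -1) ++ nseq u (1, 0, 0) ++ nseq v (0, 1, 1))
    pm1_triple 0.

(* [if] instead of [==>], which would evaluate the count on all quadruples. *)
Definition pair_check p q u v : bool :=
  if ((p + q + u)%N \in [:: 7; 9]%N) && ((p + q + v)%N \in [:: 3; 5; 7; 9]%N) && (v <= 1)%N
     || (p + q + u == 5)%N && (p + q + v == 5)%N
  then if (15 * 2 ^ (p + q + u + v) < 32 * pair_count p q u v)%N
       then [&& (p == 0%N) || (q == 0%N), u == v & (u <= (p + q + u == 5))%N]
       else true
  else true.

(** The ranges suffice because the first row has at most nine entries and at most five spins belong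
    to the second row alone. *)
Lemma pair_checkT : all (fun p => all (fun q => all (fun u => all (pair_check p q u)
  (iota 0 6)) (iota 0 10)) (iota 0 10)) (iota 0 10).
Proof. by vm_compute. Qed.

Lemma eqN11 (R : numDomainType) : ((-1 : R) == 1) = false.
Proof. by apply/negbTE; rewrite lt_eqF // (@lt_trans _ _ 0) ?ltrN10 ?ltr01. Qed.

Lemma eq1N1 (R : numDomainType) : ((1 : R) == -1) = false.
Proof. by rewrite eq_sym eqN11. Qed.

(** * Exact counting for rows with entries 0, 1, -1 *)

Section UnitRows.
Variables (I : finType) (F : realFieldType).
Notation cube := {ffun I -> bool}.
Notation row := {ffun I -> F}.
Implicit Types (x : cube) (P Q : cube -> bool) (l : row) (L : seq row) (W : {set I}).

(** The field [F] is abstract; over the integers [sign_count] can be evaluated. *)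
Definition int_row l (i : I) : int := if l i == 1 then 1 else if l i == -1 then -1 else 0.

Lemma int_rowE l i : unit_row l -> (int_row l i)%:~R = l i.
Proof.
move=> /forall_inP ul; rewrite /int_row; case: eqP => [->//|n1]; case: eqP => [->//|n2].
case: (boolP (i \in supp l)) => [/ul/orP[]/eqP//|/suppN->//].
Qed.

Lemma sat_intr l (z : I -> int) x : (forall i, l i = (z i)%:~R) ->
  sat l x = pm1 (dot z x).
Proof.
move=> lz; rewrite /sat; have -> : dot l x = (dot z x)%:~R.
  rewrite /dot rmorph_sum; apply: eq_bigr => i _.
  by case: (x i); rewrite ?rmorphN /= lz.
by rewrite /pm1 -(eqr_int F (dot z x) 1) -(eqr_int F (dot z x) (-1)).
Qed.

Lemma sat_int l x : unit_row l -> sat l x = pm1 (dot (int_row l) x).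
Proof. by move=> ul; apply: sat_intr => i; rewrite int_rowE. Qed.

Definition int_rows l1 l2 l3 (i : I) := (int_row l1 i, int_row l2 i, int_row l3 i).

Lemma dot_int_rows l1 l2 l3 x : dot (int_rows l1 l2 l3) x =
  (dot (int_row l1) x, dot (int_row l2) x, dot (int_row l3) x).
Proof.
have proj (f : int * int * int -> int) : {morph f : y z / y + z} -> f 0 = 0 ->
    {morph f : y / - y} -> f (dot (int_rows l1 l2 l3) x) = dot (f \o int_rows l1 l2 l3) x.
  move=> fD f0 fN; rewrite /dot (big_morph f fD f0); apply: eq_bigr => i _.
  by case: (x i); rewrite /= ?fN.
rewrite [LHS]surjective_pairing [X in (X, _) = _]surjective_pairing.
by rewrite (proj (fun t => t.1.1)) ?(proj (fun t => t.1.2)) ?(proj snd).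
Qed.

Lemma dens_Sat3_count (U : seq I) l1 l2 l3 :
  unit_row l1 -> unit_row l2 -> unit_row l3 -> uniq U ->
  (forall i, i \notin U -> [/\ l1 i = 0, l2 i = 0 & l3 i = 0]) ->
  dens (Sat [:: l1; l2; l3]) * 2 ^+ size U =
    (sign_count (map (int_rows l1 l2 l3) U) pm1_triple 0)%:R.
Proof.
move=> u1 u2 u3 Uu U0; rewrite -(dens_dot_count _ Uu) => [|i /U0[e1 e2 e3]].
  congr (_ * _); apply: eq_dens => x.
  by rewrite dot_int_rows /Sat /= andbT !sat_int.
rewrite /int_rows /int_row e1 e2 e3 eq_sym oner_eq0 eq_sym oppr_eq0 oner_eq0 //.
Qed.

Lemma unit_rowP l i : unit_row l -> i \in supp l -> l i = 1 \/ l i = -1.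
Proof. by move=> /forall_inP ul /ul /orP[]/eqP; [left|right]. Qed.

Lemma dens_unit_row r l : unit_row l -> #|supp l| = r ->
  dens (sat l) * 2 ^+ r = (pair_count r 0 0 0)%:R.
Proof.
move=> ul lr; have := @dens_Sat3_count (enum (supp l)) l l l ul ul ul (enum_uniq _).
rewrite -cardE lr (@eq_dens _ _ (sat l)) => [->|x]; last first.
  by rewrite /Sat /= andbT !andbb.
  by move=> i; rewrite mem_enum => /suppN->.
rewrite -[map _ _]cats0 (@sign_count_block _ _ _ (1, 1, 1)) ?size_map -?cardE ?lr //.
move=> b /mapP[i]; rewrite mem_enum => /(unit_rowP ul) h ->; rewrite /int_rows /int_row.
have n11 := eqN11 F.
by case: h => ->; rewrite ?n11 ?eqxx; [left|right].
Qed.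

Section Pair.
Variables (l1 l2 : row).
Hypotheses (u1 : unit_row l1) (u2 : unit_row l2).

Let same := [set i in supp l1 | l2 i == l1 i].
Let opposite := [set i in supp l1 | l2 i == - l1 i].

Lemma dens_pair_count : dens (Sat [:: l1; l2]) *
    2 ^+ (#|same| + #|opposite| + #|supp l1 :\: supp l2| + #|supp l2 :\: supp l1|) =
  (pair_count #|same| #|opposite| #|supp l1 :\: supp l2| #|supp l2 :\: supp l1|)%:R.
Proof.
have n11 := eqN11 F.
have n01 : ((0 : F) == 1) = false by apply/eqP => e; lra.
have n0m : ((0 : F) == -1) = false by apply/eqP => e; lra.
pose U := enum same ++ enum opposite ++ enum (supp l1 :\: supp l2) ++ enum (supp l2 :\: supp l1).
have -> : (#|same| + #|opposite| + #|supp l1 :\: supp l2| + #|supp l2 :\: supp l1|)%N = size U.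
  by rewrite !size_cat -!cardE !addnA.
rewrite -(@eq_dens _ (Sat [:: l1; l2; l2])) => [|x]; last by rewrite /Sat /= !andbT andbb.
rewrite dens_Sat3_count //; first last.
- move=> i; rewrite !mem_cat !mem_enum !inE !negb_or !negb_and !negbK.
  case: (eqVneq (l1 i) 0) => [->|ne1] /=; first by case: eqP => [->|].
  case: (eqVneq (l2 i) 0) => [->|ne2] /=; first by rewrite !andbF.
  have i1 : i \in supp l1 by rewrite inE.
  have i2 : i \in supp l2 by rewrite inE.
  by case: (unit_rowP u1 i1) => ->; case: (unit_rowP u2 i2) => ->; rewrite ?opprK ?eqxx ?andbF.
- have ab i : (l2 i == l1 i) || (l2 i == - l1 i) -> (l2 i == 0) = (l1 i == 0).
    by case/orP=> /eqP->; rewrite ?oppr_eq0.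
  have so i : l2 i == l1 i -> l2 i == - l1 i -> l1 i == 0.
    by move=> /eqP-> /eqP h; apply/eqP; lra.
  rewrite !cat_uniq !enum_uniq /= !andbT; apply/and3P; split; apply/hasPn => i;
    rewrite !(mem_cat, mem_enum, inE); move: (ab i) (so i);
    by case: (l1 i == 0); case: (l2 i == 0); case: (l2 i == l1 i); case: (l2 i == - l1 i) => // h1 h2;
      try (by have := h1 isT); try (by have := h2 isT isT).
rewrite /pair_count /U !map_cat; congr (_%:R).
rewrite (@sign_count_block _ _ _ (1, 1, 1)) ?size_map -?cardE; last first.
  move=> b /mapP[i]; rewrite mem_enum inE => /andP[i1 /eqP i2] ->; rewrite /int_rows /int_row i2.
  by case: (unit_rowP u1 i1) => ->; rewrite ?n11 ?eqxx; [left|right].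
apply: sign_count_cat => y1.
rewrite (@sign_count_block _ _ _ (1, -1, -1)) ?size_map -?cardE; last first.
  move=> b /mapP[i]; rewrite mem_enum inE => /andP[i1 /eqP i2] ->; rewrite /int_rows /int_row i2.
  by case: (unit_rowP u1 i1) => ->; rewrite ?opprK ?n11 ?eqxx; [left|right].
apply: sign_count_cat => y2.
rewrite (@sign_count_block _ _ _ (1, 0, 0)) ?size_map -?cardE; last first.
  move=> b /mapP[i]; rewrite mem_enum in_setD => /andP[/suppN i2 i1] ->; rewrite /int_rows /int_row i2.
  by case: (unit_rowP u1 i1) => ->; rewrite ?n01 ?n0m ?n11 ?eqxx; [left|right].
apply: sign_count_cat => y3.
rewrite -[map _ _]cats0 -[nseq #|supp l2 :\: supp l1| _]cats0.
rewrite (@sign_count_block _ _ _ (0, 1, 1)) ?size_map -?cardE //.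
move=> b /mapP[i]; rewrite mem_enum in_setD => /andP[/suppN i1 i2] ->; rewrite /int_rows /int_row i1.
by case: (unit_rowP u2 i2) => ->; rewrite ?n01 ?n0m ?n11 ?eqxx; [left|right].
Qed.

End Pair.
End UnitRows.

(** * The density gap *)

Section Gap.
Variables (I : finType) (F : realFieldType).
Notation cube := {ffun I -> bool}.
Notation row := {ffun I -> F}.
Implicit Types (x : cube) (P Q : cube -> bool) (l : row) (L : seq row) (W : {set I}).

Lemma card_suppI l1 l2 : unit_row l1 -> unit_row l2 -> #|supp l1 :&: supp l2| =
  (#|[set i in supp l1 | l2 i == l1 i]| + #|[set i in supp l1 | l2 i == - l1 i]|)%N.
Proof.
move=> u1 u2; rewrite -(cardsID [set i in supp l1 | l2 i == l1 i]).
congr (_ + _)%N; apply: eq_card => i; rewrite !inE.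
  by case: (eqVneq (l2 i) (l1 i)) => [->|_]; rewrite ?andbF ?andbT ?andbb.
case: (eqVneq (l1 i) 0) => [->|n1] /=; first by rewrite ?andbF.
case: (eqVneq (l2 i) 0) => [->|n2]; first by rewrite ?andbF eq_sym oppr_eq0 (negbTE n1).
have i1 : i \in supp l1 by rewrite inE.
have i2 : i \in supp l2 by rewrite inE.
by case: (unit_rowP u1 i1) => ->; case: (unit_rowP u2 i2) => ->;
  rewrite ?opprK ?eqxx ?eqN11 ?eq1N1.
Qed.

(** The verdict of [pair_check] in terms of rows: if the block of agreeing or that of opposite spins
    is empty, one relative sign [b] serves the whole common support. *)
Lemma pair_dichotomy l1 l2 : unit_row l1 -> unit_row l2 ->
  ((#|supp l1| \in [:: 7; 9]) && (#|supp l2| \in [:: 3; 5; 7; 9])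
     && (#|supp l2 :\: supp l1| <= 1) || (#|supp l1| == 5) && (#|supp l2| == 5))%N ->
  15 / 32 < dens (Sat [:: l1; l2]) ->
  [/\ exists2 b : bool, True & {in supp l1 :&: supp l2, forall i, l2 i = if b then l1 i else - l1 i},
      #|supp l1 :\: supp l2| = #|supp l2 :\: supp l1|
    & (#|supp l1 :\: supp l2| <= (#|supp l1| == 5%N))%N].
Proof.
move=> u1 u2 sz gt; have := dens_pair_count u1 u2.
set p := #|[set i in _ | l2 i == l1 i]|; set q := #|[set i in _ | _ == - _]|.
set u := #|_ :\: supp l2|; set v := #|_ :\: supp l1| in sz *; move=> e.
have inter : #|supp l1 :&: supp l2| = (p + q)%N := card_suppI u1 u2.
have s1 : #|supp l1| = (p + q + u)%N by rewrite -inter cardsID.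
have s2 : #|supp l2| = (p + q + v)%N by rewrite -inter setIC cardsID.
have chk : pair_check p q u v.
  have /allP/(_ p)/[!mem_iota] hp := pair_checkT.
  have p10 : (p < 10)%N by rewrite s1 s2 !inE in sz; lia.
  have q10 : (q < 10)%N by rewrite s1 s2 !inE in sz; lia.
  have u10 : (u < 10)%N by rewrite s1 s2 !inE in sz; lia.
  have v6 : (v < 6)%N by rewrite s1 s2 !inE in sz; lia.
  have /allP/(_ q)/[!mem_iota] hq := hp p10.
  have /allP/(_ u)/[!mem_iota] hu := hq q10.
  by have /allP/(_ v)/[!mem_iota] hv := hu u10; apply: hv.
rewrite s1 s2 in sz *; move: chk; rewrite /pair_check sz.
have -> : (15 * 2 ^ (p + q + u + v) < 32 * pair_count p q u v)%N.
  rewrite -(ltr_nat rat) !natrM natrX -e.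
  rewrite mulrA ltr_pM2r; last exact: pow2_gt0.
  by clear -gt; lra.
clear gt e; case/and3P => pq /eqP uv u1'; split; [|exact: uv|exact: u1'].
case/orP: pq => /eqP/card0_eq p0; [exists false|exists true]; rewrite // => i ii.
  have := p0 i; rewrite inE; move: ii; rewrite inE => /andP[i1 i2].
  rewrite i1 /= => /negbT.
  by case: (unit_rowP u1 i1) => ->; case: (unit_rowP u2 i2) => ->; rewrite ?eqxx ?opprK.
have := p0 i; rewrite inE; move: ii; rewrite inE => /andP[i1 i2].
rewrite i1 /= => /negbT.
by case: (unit_rowP u1 i1) => ->; case: (unit_rowP u2 i2) => ->; rewrite ?eqxx ?opprK ?eqxx.
Qed.

Lemma sat_opp l l' b : (forall i, l' i = if b then l i else - l i) -> sat l' =1 sat l.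
Proof.
move=> e x; rewrite /sat; case: b e => e; first by congr pm1; apply: eq_bigr => i _; rewrite e.
rewrite -pm1N; congr pm1; rewrite /dot -sumrN; apply: eq_bigr => i _.
by rewrite e; case: (x i); rewrite ?opprK.
Qed.

Definition small_unit_row l := unit_row l && (#|supp l| \in [:: 3; 5; 7; 9]%N).

(** A cutting row with two new spins leaves at most 3/4 of 70/128, below 15/32. One with at most one
    new spin equals [l] up to sign by [pair_dichotomy], and cuts nothing. *)
Lemma unit_row79 L l : {in L, forall l', trivial_row l' || small_unit_row l'} ->
  l \in L -> unit_row l -> #|supp l| \in [:: 7; 9]%N -> 15 / 32 < dens (Sat L) ->
  dens (Sat L) = dens (sat l).
Proof.
move=> LU lL ul l79 gt; case: (Sat_cut lL) => [/eq_dens//|[l2 [l2L nt2 le lt]]].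
have := LU _ l2L; rewrite (negbTE nt2) => /andP[u2 s2].
have gt2 := lt_le_trans gt le.
case: (leqP #|supp l2 :\: supp l| 1) => [v1|/dens_Sat2_far far]; last first.
  have l7 : (7 <= #|supp l|)%N by move: l79; rewrite !inE; case/orP=> /eqP->.
  have := @dens_sat_le I F 7 l l7; have -> : lo 7 2 = 70%N by [].
  by clear -far gt2; lra.
have [|[b _ bl] uv u0] := @pair_dichotomy l l2 ul u2 _ gt2; first by rewrite l79 s2 v1.
have ne5 : (#|supp l| == 5%N) = false by move: l79; rewrite !inE; case/orP=> /eqP->.
have e i : l2 i = if b then l i else - l i.
  have : supp l = supp l2.
    rewrite ne5 leqn0 in u0; apply/eqP; rewrite eqEsubset -!setD_eq0 -!cards_eq0.
    by rewrite -uv u0.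
  move=> s12; case: (boolP (i \in supp l2)) => i2; first by apply: bl; rewrite inE s12 i2.
  by move: (i2); rewrite -{1}s12 => /suppN->; rewrite (suppN i2) oppr0 if_same.
suff : dens (Sat [:: l; l2]) = dens (sat l) by move=> h; move: lt; rewrite h ltxx.
by apply: eq_dens => x; rewrite /Sat /= (sat_opp e) andbT andbb.
Qed.

(** Up to signs, the core [C] sums to 0 in 6 ways, leaving the three private spins free, and to 2 or
    -2 in 8 ways, forcing all three; 4 and -4 are excluded. This gives 48 + 8 = 56 of 128 sign
    vectors. *)
Lemma dens_sunflower l1 l2 l3 (C : {set I}) i1 i2 i3 b2 b3 :
  unit_row l1 -> unit_row l2 -> unit_row l3 -> #|C| = 4%N ->
  supp l1 = i1 |: C -> supp l2 = i2 |: C -> supp l3 = i3 |: C ->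
  uniq [:: i1; i2; i3] -> i1 \notin C -> i2 \notin C -> i3 \notin C ->
  {in C, forall i, l2 i = if b2 then l1 i else - l1 i} ->
  {in C, forall i, l3 i = if b3 then l1 i else - l1 i} ->
  dens (Sat [:: l1; l2; l3]) = 7 / 16.
Proof.
move=> u1 u2 u3 C4 s1 s2 s3 ui n1 n2 n3 e2 e3.
have nC i : i \in C -> i \notin [:: i1; i2; i3].
  by move=> iC; rewrite !inE; apply/norP; split; [|apply/norP; split];
    apply: contraTneq iC => ->.
have Uu : uniq (enum C ++ [:: i1; i2; i3]).
  rewrite cat_uniq enum_uniq ui andbT; apply/hasPn => i; apply: contraL.
  by rewrite /= mem_enum; apply: nC.
have := @dens_Sat3_count I F (enum C ++ [:: i1; i2; i3]) l1 l2 l3 u1 u2 u3 Uu.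
have -> : size (enum C ++ [:: i1; i2; i3]) = 7%N by rewrite size_cat -cardE C4.
move=> cnt; have {cnt} := cnt _; rewrite map_cat.
rewrite (@sign_count_block _ _ _ (1, if b2 then 1 else -1, if b3 then 1 else -1)); last first.
  move=> t /mapP[i]; rewrite mem_enum => iC ->; rewrite /int_rows /int_row e2 // e3 //.
  have := unit_rowP (i := i) u1; rewrite s1 !inE iC orbT => /(_ isT)[]->;
    case: b2 e2; case: b3 e3; rewrite ?opprK ?eqxx ?eqN11 ?eqxx; by [left|right].
have e11 : l1 i1 = 1 \/ l1 i1 = -1 by apply: unit_rowP; rewrite // s1 setU11.
have e22 : l2 i2 = 1 \/ l2 i2 = -1 by apply: unit_rowP; rewrite // s2 setU11.
have e33 : l3 i3 = 1 \/ l3 i3 = -1 by apply: unit_rowP; rewrite // s3 setU11.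
move: ui; rewrite /= !inE negb_or andbT => /andP[/andP[n12 n13] n23].
have e12 : l1 i2 = 0 by apply: suppN; rewrite s1 !inE eq_sym negb_or n12.
have e13 : l1 i3 = 0 by apply: suppN; rewrite s1 !inE eq_sym negb_or n13.
have e21 : l2 i1 = 0 by apply: suppN; rewrite s2 !inE negb_or n12.
have e23 : l2 i3 = 0 by apply: suppN; rewrite s2 !inE eq_sym negb_or n23.
have e31 : l3 i1 = 0 by apply: suppN; rewrite s3 !inE negb_or n13.
have e32 : l3 i2 = 0 by apply: suppN; rewrite s3 !inE negb_or n23.
have r0 : (if (0 : F) == 1 then (1 : int) else if (0 : F) == -1 then (-1 : int) else (0 : int)) = 0.
  by rewrite ![0 == _]eq_sym oppr_eq0 oner_eq0.
rewrite size_map -cardE C4 [X in _ ++ X]/= /int_rows /int_row e12 e13 e21 e23 e31 e32 !r0.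
set n := sign_count _ _ _; have n56 : n = 56%N.
  rewrite /n.
  clear -e11 e22 e33; case: e11 => ->; case: e22 => ->; case: e33 => ->; rewrite ?eqxx ?eqN11;
    by case: b2; case: b3; vm_compute.
move=> cnt; rewrite n56 in cnt.
suff : dens (Sat [:: l1; l2; l3]) * 2 ^+ 7 = 56%:R by clear; lra.
apply: cnt => i; rewrite mem_cat mem_enum !inE !negb_or => /and4P[iC ni1 ni2 ni3].
by split; apply: suppN; rewrite ?s1 ?s2 ?s3 in_setU1 negb_or ?ni1 ?ni2 ?ni3.
Qed.

Lemma unit_row5 L l : {in L, forall l', trivial_row l' || unit_row l' && (#|supp l'| == 5%N)} ->
  l \in L -> ~~ trivial_row l -> dens (Sat L) <= 15 / 32 \/ 1 / 2 <= dens (Sat L).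
Proof.
move=> LU lL nt; case: (lerP (dens (Sat L)) (15 / 32)) => [|gt]; first by left.
right; have := LU _ lL; rewrite (negbTE nt) => /andP[ul /eqP l5].
have dich l1 l2 : l1 \in L -> l2 \in L -> ~~ trivial_row l1 -> ~~ trivial_row l2 ->
  [/\ exists2 b : bool, True & {in supp l1 :&: supp l2, forall i, l2 i = if b then l1 i else - l1 i},
      #|supp l1 :\: supp l2| = #|supp l2 :\: supp l1|
    & (#|supp l1 :\: supp l2| <= 1)%N].
  move=> l1L l2L nt1 nt2; have := LU _ l1L; have := LU _ l2L.
  rewrite (negbTE nt1) (negbTE nt2) => /andP[u2 s2] /andP[u1 s1].
  have := @pair_dichotomy l1 l2 u1 u2; rewrite s1 s2 orbT; apply; first by [].
  by apply: lt_le_trans gt _; apply: dens_le => x /allP Lx; rewrite /Sat /= !Lx.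
(* On six spins the density is a multiple of 1/32, and it exceeds 15/32. *)
have dyadic (W : {set I}) : {in L, forall l', trivial_row l' || (supp l' \subset W)} ->
    (#|W| <= 6)%N -> 1 / 2 <= dens (Sat L).
  move=> LW W6; have [c e] := dens_Sat_dyadic LW W6.
  rewrite leNgt; apply/negP => lt; have := @ltr_natS_le c 15.
  by clear -gt lt e; lra.
case: (boolP (all (fun l' => trivial_row l' || (supp l' \subset supp l)) L)) => [/allP h|].
  by apply: (dyadic (supp l)); rewrite ?l5.
rewrite -has_predC => /hasP[l2 l2L]; rewrite /= negb_or => /andP[nt2 ns2].
have := LU _ l2L; rewrite (negbTE nt2) => /andP[u2 /eqP s2].
(* A row not supported in [supp l] trades exactly one spin [i] of [l] for a new spin [i']. *)
have near l' : l' \in L -> ~~ trivial_row l' -> ~~ (supp l' \subset supp l) ->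
    exists i i' b, [/\ i \in supp l, supp l' = i' |: (supp l :\ i), i' \notin supp l
      & {in supp l :\ i, forall j, l' j = if b then l j else - l j}].
  move=> l'L nt' ns'; have [[b _ al] e le1] := dich _ _ lL l'L nt nt'; clear dyadic dich gt.
  have gt0 : (0 < #|supp l' :\: supp l|)%N by rewrite lt0n cards_eq0 setD_eq0.
  have /eqP/cards1P[i' di'] : #|supp l' :\: supp l| = 1%N.
    by apply/eqP; rewrite eqn_leq gt0 -e le1.
  have /eqP/cards1P[i di] : #|supp l :\: supp l'| = 1%N.
    by apply/eqP; rewrite eqn_leq le1 e gt0.
  have mi k : (k \notin supp l') && (k \in supp l) = (k == i).
    by move/setP/(_ k): di; rewrite in_setD in_set1.
  have mi' k : (k \notin supp l) && (k \in supp l') = (k == i').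
    by move/setP/(_ k): di'; rewrite in_setD in_set1.
  exists i, i', b; split.
  - by have := mi i; rewrite eqxx => /andP[].
  - apply/setP => k; rewrite in_setU1 in_setD1 -mi -mi'.
    by case: (k \in supp l); case: (k \in supp l').
  - by have := mi' i'; rewrite eqxx => /andP[].
  - move=> k; rewrite in_setD1 -mi => /andP[h1 h2]; apply: al.
    by rewrite in_setI h2; move: h1; rewrite h2 andbT negbK.
have [i1 [i2 [b2 [i1l e2 i2l al2]]]] := near l2 l2L nt2 ns2.
case: (boolP (all (fun l' => trivial_row l' || (supp l' \subset supp l :|: supp l2)) L))
  => [/allP h|].
  apply: (dyadic (supp l :|: supp l2)); first exact: h.
  rewrite card_suppU l5; have [_ <- d1] := dich _ _ lL l2L nt nt2; exact: (leq_add (leqnn 5) d1).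
rewrite -has_predC => /hasP[l3 l3L]; rewrite /= negb_or => /andP[nt3 ns3].
have ns3' : ~~ (supp l3 \subset supp l).
  by apply: contra ns3 => h; apply: subset_trans h (subsetUl _ _).
have [j [i3 [b3 [jl e3 i3l al3]]]] := near l3 l3L nt3 ns3'.
have := LU _ l3L; rewrite (negbTE nt3) => /andP[u3 _].
have i32 : i3 \notin supp l2.
  apply: contra ns3 => i3l2; apply/subsetP => k.
  by rewrite e3 in_setU1 in_setU in_setD1 => /orP[/eqP->|/andP[_ ->//]]; rewrite i3l2 orbT.
(* If [l3] dropped a spin other than [i1], both [i1] and [i3] would be in [l3] and not in [l2], but
   these rows differ by at most one spin. *)
have ji : j = i1.
  apply/eqP/negPn/negP => ji.
  have i13 : i1 \in supp l3 by rewrite e3 in_setU1 in_setD1 i1l (eq_sym i1 j) ji orbT.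
  have i12 : i1 \notin supp l2.
    rewrite e2 in_setU1 in_setD1 eqxx orbF; apply: contraNneq i2l => <-; exact: i1l.
  have [_ e d] := dich _ _ l2L l3L nt2 nt3; rewrite e in d.
  have : i1 = i3.
    by apply: (card_le1_eqP d); rewrite in_setD ?i12 ?i32 // e3 in_setU1 eqxx.
  by move=> h; move: i3l; rewrite -h i1l.
subst j; exfalso.
have C4 : #|supp l :\ i1| = 4%N by have := cardsD1 i1 (supp l); rewrite i1l l5; clear; lia.
have i1C : i1 \notin supp l :\ i1 by rewrite in_setD1 eqxx.
have i2C : i2 \notin supp l :\ i1 by apply: contra i2l => /setD1P[].
have i3C : i3 \notin supp l :\ i1 by apply: contra i3l => /setD1P[].
have e1 : supp l = i1 |: (supp l :\ i1) by rewrite setD1K.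
have ui : uniq [:: i1; i2; i3].
  rewrite /= !inE negb_or andbT; apply/andP; split; first (apply/andP; split).
  - by apply: contraNneq i2l => <-.
  - by apply: contraNneq i3l => <-.
  - by apply: contraNneq i32 => <-; rewrite e2 setU11.
have := dens_sunflower ul u2 u3 C4 e1 e2 e3 ui i1C i2C i3C al2 al3.
have : dens (Sat L) <= dens (Sat [:: l; l2; l3]).
  by apply: dens_le => x /allP Lx; rewrite /Sat /= !Lx.
by clear -gt; move=> le e; have : (1 : rat) < 0 by lra; rewrite ltr10.
Qed.

Lemma dens_gap L : [\/ dens (Sat L) <= 15 / 32, 1 / 2 <= dens (Sat L)
  | dens (Sat L) = 126 / 256].
Proof.
case: (lerP (dens (Sat L)) (15 / 32)) => [|gt]; first by constructor 1.
case: (lerP (1 / 2) (dens (Sat L))) => [|lt]; first by constructor 2.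
have nhalf : ~ (dens (Sat L) <= 15 / 32 \/ 1 / 2 <= dens (Sat L)).
  by case=> h; have := le_lt_trans h; [move/(_ _ gt)|move/(_ _ lt)]; rewrite ltxx.
have LU : {in L, forall l, trivial_row l || small_unit_row l}.
  move=> l lL; case: (row_cases l) => [->//|[d s]|d|[u s]].
  - by case: nhalf; case: (half_row lL s d) => [?|->]; [left|right].
  - by case: nhalf; left; apply: le_trans d; apply: Sat_le.
  - by rewrite /small_unit_row u s orbT.
case: (boolP (all (@trivial_row I F) L)) => [/allP tL|].
  case: nhalf; right; rewrite dens_true; first by lra.
  by move=> x; apply/allP => l /tL/trivialP.
rewrite -has_predC => /hasP[l0 l0L /= nt0].
case: (boolP (has (fun l => unit_row l && (#|supp l| \in [:: 7; 9]%N)) L))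
  => [/hasP[l lL /andP[ul l79]]|no79].
  have dl := unit_row79 LU lL ul l79 gt; rewrite dl in gt lt *.
  (* Seven entries give 70/128, above 1/2, a contradiction; nine give 252/512 = 126/256. *)
  move: l79; rewrite !inE => /orP[]/eqP s.
    have := dens_unit_row ul s; have -> : pair_count 7 0 0 0 = 70%N by vm_compute.
    by clear -lt => e; have : (1 : rat) < 0 by lra; rewrite ltr10.
  have := dens_unit_row ul s; have -> : pair_count 9 0 0 0 = 252%N by vm_compute.
  by constructor 3; lra.
case: (boolP (has (fun l => unit_row l && (#|supp l| == 3%N)) L))
  => [/hasP[l lL /andP[ul /eqP l3]]|no3].
  by case: nhalf; apply: unit_row3 lL l3 ul.
case: nhalf; apply: unit_row5 l0L nt0 => l lL.
case: (boolP (trivial_row l)) (LU _ lL) => // _ /andP[ul].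
move/hasPn/(_ _ lL): no79; move/hasPn/(_ _ lL): no3; rewrite ul !inE /=.
move: #|supp l| => n; clear.
by case: (n == 3%N); case: (n == 5%N); case: (n == 7%N); case: (n == 9%N).
Qed.
End Gap.

(** * From subspaces to systems of rows *)

Section Hat.
Variables (F : realFieldType) (k : nat).
Notation col := {ffun 'I_k -> F}.
Implicit Types (b : col) (x : {ffun 'I_k -> bool}).

Definition zero_one (y : F) := (y == 0) || (y == 1).

Definition lincomb b x : F := \sum_i (x i)%:R * b i.

(* Writing [x i = (1 - sigma i) / 2] turns [lincomb b x \in {0, 1}] into [sat]
   for a row with one extra spin, namely the spin of index [ord0]. *)
Definition hat b : {ffun 'I_k.+1 -> F} :=
  [ffun i => if unlift ord0 i is Some j then - b j else (\sum_j b j) - 1].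

(** The extra spin is set to +1; the solutions where it is -1 are the global opposites. *)
Definition extend x : {ffun 'I_k.+1 -> bool} :=
  [ffun i => if unlift ord0 i is Some j then x j else false].

Lemma sat_hat b x : sat (hat b) (extend x) = zero_one (lincomb b x).
Proof.
have -> : zero_one (lincomb b x) = pm1 (2 * lincomb b x - 1).
  rewrite /zero_one /pm1 orbC; congr (_ || _); apply/eqP/eqP => h; lra.
rewrite /sat; congr pm1; rewrite /dot big_ord_recl !ffunE unlift_none.
rewrite addrAC; congr (_ - 1); rewrite /lincomb mulr_sumr -big_split.
by apply: eq_bigr => i _; rewrite /= !ffunE !liftK; case: (x i) => /=; lra.
Qed.

(** By sign symmetry half of the solutions have extra spin +1, hence the exponent [k] although there
    are [k + 1] spins. *)
Lemma card_lincomb (bs : seq col) :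
  #|[set x | all (fun b => zero_one (lincomb b x)) bs]|%:R
    = dens (Sat (map hat bs)) * 2 ^+ k.
Proof.
rewrite /dens card_ord exprS (@card_half _ (Sat (map hat bs)) ord0); last first.
  by move=> x; apply: eq_all => l; rewrite sat_neg.
rewrite natrM; have -> : #|[set x | all (fun b => zero_one (lincomb b x)) bs]| =
  #|[pred y | Sat (map hat bs) y && ~~ y ord0]|; last first.
  have : (2 : rat) ^+ k != 0 by rewrite lt0r_neq0 ?pow2_gt0.
  by move=> k0; move: (2 ^+ k) k0 => E k0; field.
have extI : injective extend.
  move=> x y /ffunP e; apply/ffunP => i; have := e (lift ord0 i).
  by rewrite !ffunE liftK.
rewrite -(card_imset _ extI); apply: eq_card => y; rewrite inE.
apply/imsetP/andP => [[x + ->]|[Sy y0]].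
  rewrite inE /Sat all_map => h; split; last by rewrite ffunE unlift_none.
  by apply: sub_all h => b; rewrite /= sat_hat.
have ey : y = extend [ffun i => y (lift ord0 i)].
  apply/ffunP => i; rewrite ffunE; case: unliftP => [j ->|->]; rewrite ?ffunE //.
  exact: negbTE.
exists [ffun i => y (lift ord0 i)] => //; rewrite inE; move: Sy; rewrite {1}ey /Sat all_map.
by apply: sub_all => b /=; rewrite sat_hat.
Qed.

End Hat.

(** * Cube points of row spaces *)

Section Subspaces.
Local Notation R := Rdefinitions.R.

(** Through the identity block, [u] can be read off the columns [f] of [u *m B]. So a cube vector of
    the row space comes from a cube point, subject to all coordinates being 0 or 1. *)
Lemma cube_count_section (k n : nat) (A B : 'M[R]_(k, n)) (f : 'I_k -> 'I_n) :
  (A :=: B)%MS -> colsub f B = 1%:M ->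
  cube_count A = #|[set x : {ffun 'I_k -> bool} |
    all (fun b => zero_one (lincomb b x)) [seq [ffun i => B i j] | j <- enum 'I_n]]|.
Proof.
move=> AB fB; set X := [set x | _].
have entry (x : {ffun 'I_k -> bool}) j :
    (cube_vec x *m B) 0 j = lincomb [ffun i => B i j] x.
  by rewrite mxE; apply: eq_bigr => i _; rewrite !mxE ffunE.
have inX x : x \in X -> forall j, zero_one ((cube_vec x *m B) 0 j).
  by rewrite inE => /allP h j; rewrite entry; apply/h/map_f; rewrite mem_enum.
pose g (x : {ffun 'I_k -> bool}) : {ffun 'I_n -> bool} :=
  [ffun j => (cube_vec x *m B) 0 j == 1].
have gE x : x \in X -> cube_vec (g x) = cube_vec x *m B.
  move=> /inX xX; apply/rowP => j; rewrite mxE ffunE.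
  by case/orP: (xX j) => /eqP->; rewrite ?eqxx // eq_sym oner_eq0.
have sub x : colsub f (cube_vec x *m B) = cube_vec x.
  by rewrite -mulmx_colsub fB mulmx1.
have vecI n' : injective (@cube_vec n').
  move=> x y /rowP e; apply/ffunP => i; have := e i; rewrite !mxE.
  by move/eqP; rewrite eqr_nat; case: (x i); case: (y i).
rewrite -(@card_in_imset _ _ g) => [|x y xX yX exy]; last first.
  by apply: vecI; rewrite -(sub x) -(sub y) -!gE ?exy.
apply: eq_card => v; rewrite inE AB; apply/idP/imsetP => [/submxP[u vu]|[x xX ->]]; last first.
  by rewrite gE // submxMl.
pose x := [ffun i => v (f i)].
have xu : cube_vec x = u.
  by rewrite -[u]mulmx1 -fB mulmx_colsub -vu; apply/rowP => i; rewrite !mxE ffunE.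
have vx : cube_vec v = cube_vec x *m B by rewrite xu.
have xX : x \in X.
  rewrite inE; apply/allP => _ /mapP[j _ ->]; rewrite -entry -vx mxE.
  by rewrite /zero_one; case: (v j); rewrite eqxx ?orbT.
by exists x => //; apply: vecI; rewrite gE.
Qed.

(** Full rank gives [k] independent columns; multiplying by the inverse of that block creates an
    identity block and keeps the row space. *)
Lemma cube_count_dens (k n : nat) (A : 'M[R]_(k, n)) : \rank A = k ->
  exists L : seq {ffun 'I_k.+1 -> R}, (cube_count A)%:R = dens (Sat L) * 2 ^+ k.
Proof.
move=> rA; have full : row_full A^T by rewrite /row_full mxrank_tr rA.
pose f := fullrankfun full; pose C := colsub f A.
have uC : C \in unitmx.
  have -> : C = (rowsub f A^T)^T by apply/matrixP => i j; rewrite !mxE.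
  by rewrite unitmx_tr fullrowsub_unit.
eexists; rewrite (@cube_count_section _ _ A (invmx C *m A) f); first exact: card_lincomb.
  by apply: eqmx_sym; apply: eqmxMfull; rewrite row_full_unit unitmx_inv.
by rewrite -mulmx_colsub mulVmx.
Qed.

(** The matrix is the identity followed by one column, [c] padded with zeros, and then zero columns.
    The exponent 9 counts the eight spins of [c] and the extra one. *)
Lemma Hset_realize (k m : nat) (c : seq int) : size c = 8%N -> (8 <= k)%N -> (0 < m)%N ->
  exists2 s, Hset (k + m) k s & s%:R * 2 ^+ 9 =
    (sign_count (\sum_(i <- c) i - 1 :: map -%R c) (@pm1 _) 0)%:R * (2 : rat) ^+ k.
Proof.
case: m => // m c8 k8 _.
pose b : {ffun 'I_k -> R} := [ffun i : 'I_k => (nth 0 c i)%:~R].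
pose A : 'M[R]_(k, k + m.+1) :=
  row_mx 1%:M (\matrix_(i, j) (if j == ord0 then b i else 0)).
have sA : colsub (@lshift k m.+1) A = 1%:M.
  by apply/matrixP => i j; rewrite mxE row_mxEl.
exists (cube_count A).
  exists A; split=> //; apply/eqP/row_freeP; exists (col_mx 1%:M 0).
  by rewrite mul_row_col mulmx1 mulmx0 addr0.
rewrite (@cube_count_section _ _ A A (@lshift k m.+1)) //.
have -> : [set x | all (fun b => zero_one (lincomb b x)) [seq [ffun i => A i j] | j <- enum 'I_(k + m.+1)]]
   = [set x | all (fun b => zero_one (lincomb b x)) [:: b]].
  apply/setP => x; rewrite !inE /= andbT; apply/allP/idP => [h|h _ /mapP[j _ ->]].
    have := h [ffun i => A i (rshift k ord0)]; rewrite (_ : [ffun i => _] = b).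
      apply; apply/mapP; exists (rshift k ord0); rewrite ?mem_enum //.
      by apply/ffunP => i; rewrite [RHS]ffunE row_mxEr mxE eqxx.
    by apply/ffunP => i; rewrite ffunE row_mxEr mxE eqxx.
  case: (split_ordP j) => i ->; last first.
    case: (eqVneq i ord0) => i0; last first.
      rewrite /lincomb big1 /zero_one ?eqxx // => i' _.
      by rewrite ffunE row_mxEr mxE (negbTE i0) mulr0.
    rewrite (_ : [ffun i' => _] = b) //.
    by apply/ffunP => i'; rewrite ffunE row_mxEr mxE i0 eqxx.
  rewrite /lincomb (bigD1 i) //= big1 => [|i' ne].
    by rewrite ffunE row_mxEl mxE eqxx mulr1 addr0; case: (x i); rewrite /zero_one eqxx ?orbT.
  by rewrite ffunE row_mxEl mxE (negbTE ne) mulr0.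
rewrite card_lincomb [map _ _]/= mulrAC; congr (_ * _).
pose z (i : 'I_k.+1) : int := if unlift ord0 i is Some j then - nth 0 c j else \sum_(i <- c) i - 1.
have sumc : \sum_(i < k) nth 0 c i = \sum_(i <- c) i.
  have tail0 : \sum_(8 <= i < k) nth 0 c i = 0.
    by rewrite big_nat big1 // => i /andP[i8 _]; rewrite nth_default ?c8.
  rewrite -(big_mkord xpredT (nth 0 c)) (big_cat_nat _ (n := 8)) //= tail0 addr0.
  by rewrite [RHS](big_nth 0) c8.
have hatz i : hat b i = (z i)%:~R.
  rewrite /z ffunE; case: unliftP => [j _|_]; first by rewrite ffunE rmorphN.
  rewrite rmorphB /= -sumc rmorph_sum; congr (_ - _).
  by apply: eq_bigr => j _; rewrite ffunE.
rewrite (@eq_dens _ _ (fun x => pm1 (dot z x))) => [|x]; last first.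
  by rewrite /Sat /= andbT; apply: sat_intr.
(* Only these nine spins can have nonzero coefficients, so the count does not depend on [k]. *)
pose U := ord0 :: [seq lift ord0 (widen_ord k8 i) | i <- enum 'I_8].
have sU : size U = 9%N by rewrite /= size_map size_enum_ord.
rewrite -sU dens_dot_count.
- congr (sign_count _ _ _)%:R; rewrite /= {1}/z unlift_none; congr (_ :: _).
  rewrite -map_comp -[in RHS](mkseq_nth 0 c) c8 /mkseq -val_enum_ord -!map_comp.
  by apply: eq_map => i; rewrite /= /z liftK.
- rewrite /= map_inj_uniq ?enum_uniq ?andbT; last first.
    by move=> i j /lift_inj /(congr1 val) /= /val_inj.
  by apply/mapP => -[i _ /(congr1 val)].
- move=> i; rewrite inE negb_or => /andP[i0 iU]; rewrite /z.
  case: unliftP i0 iU => [j -> _ jU|->]; last by rewrite eqxx.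
  rewrite nth_default ?oppr0 // c8 leqNgt; apply: contra jU => j8.
  by apply/mapP; exists (Ordinal j8); rewrite ?mem_enum //; congr lift; apply: val_inj.
Qed.

End Subspaces.

(* The sizes in the top interval *)
Local Close Scope ring_scope.

Theorem theorem1p2 (k m : nat) : 8 <= k -> 1 <= m ->
  forall s : nat,
    (Hset (k + m) k s /\ 15 * 2 ^ (k - 1) <= 16 * s /\ s <= 2 ^ (k - 1)) <->
    (16 * s = 15 * 2 ^ (k - 1) \/ 128 * s = 126 * 2 ^ (k - 1) \/ s = 2 ^ (k - 1)).
Proof.
move=> k8 m1 s; have E2 : (2 ^ k = 2 * 2 ^ (k - 1))%N by rewrite -expnS; congr expn; lia.
have E0 : 0 < 2 ^ (k - 1) by rewrite expn_gt0.
split=> [[[A [rA ->]] [lo up]]|].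
  have [L] := cube_count_dens rA; rewrite -natrX E2.
  move: (cube_count A) (2 ^ (k - 1)) E0 lo up {E2} => c E E0 lo up e.
  have E0' : (0 < E%:R :> rat)%R by rewrite ltr0n.
  have e' : (c%:R = 2 * (dens (Sat L) * E%:R) :> rat)%R by rewrite e natrM mulrCA.
  (* The assumed bounds on the size turn the first two alternatives into equalities. *)
  case: (dens_gap L) => h.
  - left; apply/eqP; rewrite eqn_leq lo andbT -(ler_nat rat) !natrM e'.
    by have := ler_wpM2r (ltW E0') h; lra.
  - right; right; apply/eqP; rewrite eqn_leq up /= -(ler_nat rat) e'.
    by have := ler_wpM2r (ltW E0') h; lra.
  - right; left; apply/eqP; rewrite -(eqr_nat rat) !natrM e' h; apply/eqP.
    by lra.
have realize (c : seq int) n : size c = 8 -> sign_count (\sum_(i <- c) i - 1 :: map -%R c)%R (@pm1 _) 0%R = n ->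
    n * 2 ^ k = 512 * s -> Hset (k + m) k s.
  move=> c8 cn es; have [s' Hs' /eqP] := Hset_realize c8 k8 m1.
  rewrite cn -!natrX -!natrM eqr_nat => /eqP e.
  suff -> : s = s' by [].
  by apply/eqP; rewrite -(eqn_pmul2l (isT : 0 < 512)) -es -e mulnC.
case=> [e|[e|e]]; (split; last by lia).
(* The row has entries 2, -1, -1, -1, -1, 1 and density 240/512 = 15/32. *)
- apply: (realize [:: 1; 1; 1; 1; -1; 0; 0; 0]%R 240) => //; last by lia.
  by rewrite !big_cons big_nil; vm_compute.
(* All nine entries are 1 or -1, with density 252/512. *)
- apply: (realize [:: 1; 1; 1; 1; -1; -1; -1; -1]%R 252) => //; last by lia.
  by rewrite !big_cons big_nil; vm_compute.
(* The entries -2 and 1 require two equal spins, with density 256/512. *)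
- apply: (realize [:: -1; 0; 0; 0; 0; 0; 0; 0]%R 256) => //; last by lia.
  by rewrite !big_cons big_nil; vm_compute.
Qed.
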